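(* In the setting described in the context, for any $\phi\ge\sqrt n$ the expected number of edges on the path output by the shadow vertex algorithm (from $x_0$ to a vertex $x_c$ maximizing $c^{\mathsf T}x$ over $P$) is $O\big(\frac{mn^2}{\delta^2}+\frac{m\sqrt n\,\phi}{\delta}\big)$.
   Context: Let $A=[a_1,\dots,a_m]^{\mathsf T}\in\mathbb{R}^{m\times n}$ with $\|a_i\|=1$ for all $i$ (Euclidean norm), $b\in\mathbb{R}^m$, and assume $P=\{x\in\mathbb{R}^n\mid Ax\le b\}$ is bounded and non-degenerate (every vertex has exactly $n$ tight constraints, which are linearly independent). Let $\delta$ be the minimum, over all $I\subseteq[m]$ and $j\in[m]$ with $a_j\notin\operatorname{span}\{a_i\mid i\in I\}$, of the distance from $a_j$ to $\operatorname{span}\{a_i\mid i\in I\}$. Let $c_0\in\mathbb{R}^n$ with $\|c_0\|=1$ and let $x_0$ be a vertex of $P$. The shadow vertex algorithm with parameter $\phi$: (1) for each $i$ choose an arbitrary interval $I_i\subseteq[-1,1]$ of length $1/\phi$ containing $(c_0)_i$, and draw $c_i$ independently uniformly from $I_i$; (2) let $u_1,\dots,u_n$ be the $n$ linearly independent rows of $A$ with $u_k^{\mathsf T}x_0=b_k$ (the tight rows at $x_0$); (3) draw $\lambda\in(0,1]^n$ uniformly at random (independent of $c$); (4) set $w=-[u_1,\dots,u_n]\lambda$; (5) project $P$ onto the plane via $\pi(x)=(c^{\mathsf T}x,w^{\mathsf T}x)$, obtaining polygon $P'=\pi(P)$; (6) walk from $\pi(x_0)$ along the edges of $P'$ (its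 lower envelope) in increasing direction of the first coordinate until a rightmost vertex of $P'$ is reached; each edge of $P'$ traversed corresponds to an edge of $P$, and the output path is the corresponding path of vertices of $P$ from $x_0$ to the vertex $x_c$ projected onto that rightmost vertex. *)

(* Defs.v *)
(* Points of R^n and of the plane are row vectors. *)
From HB Require Import structures.
From mathcomp Require Import all_boot all_order all_algebra.
From mathcomp Require Import all_classical all_reals all_analysis.

Set Implicit Arguments.
Unset Strict Implicit.
Unset Printing Implicit Defensive.

Import Order.TTheory GRing.Theory Num.Theory.
Import numFieldNormedType.Exports.
Local Open Scope classical_set_scope.
Local Open Scope ring_scope.

Section Euclidean.
Context {R : realType} {n : nat}.
Implicit Types (u v : 'rV[R]_n) (U : 'M[R]_n) (Q F : set 'rV[R]_n).

Definition dot u v : R := \sum_(i < n) u 0 i * v 0 i.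

(* The library norm on matrices is the max norm, hence this definition. *)
Definition enorm u : R := Num.sqrt (dot u u).

(* U stands for its row space. *)
Definition dist_span v U : R :=
  inf [set enorm (v - y) | y in [set y : 'rV[R]_n | (y <= U)%MS]].

Definition segment u v : set 'rV[R]_n :=
  [set (1 - t) *: u + t *: v | t in `[0, 1]].

(* Nonempty faces only matter below; l = 0 gives Q itself. *)
Definition face Q F : Prop :=
  exists l : 'rV[R]_n,
    F = [set x | Q x /\ forall y, Q y -> dot l y <= dot l x].

Definition vertex Q u : Prop := face Q [set u].

Definition edge Q u v : Prop := u <> v /\ face Q (segment u v).

End Euclidean.

Section Polyhedron.
Context {R : realType} {m n : nat}.
Implicit Types (A : 'M[R]_(m, n)) (b : 'cV[R]_m) (x : 'rV[R]_n).

Definition polyhedron A b : set 'rV[R]_n :=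
  [set x | forall i, dot (row i A) x <= b i 0].

Definition tight A b x : {set 'I_m} :=
  [set i | dot (row i A) x == b i 0]%SET.

Definition nondegenerate_polyhedron A b : Prop :=
  forall x, vertex (polyhedron A b) x ->
    #|tight A b x| = n /\
    row_free (rowsub (fun k : 'I_#|tight A b x| => enum_val k) A).

Definition row_span A (I : {set 'I_m}) : 'M[R]_n :=
  (\sum_(i in I) <<row i A>>)%MS.

(* The infimum ranges over a finite set of values, so it is a minimum as soon
   as some row of A is nonzero (take I empty). *)
Definition delta A : R :=
  inf [set dist_span (row Ij.2 A) (row_span A Ij.1) |
        Ij in [set Ij : {set 'I_m} * 'I_m |
                ~~ (row Ij.2 A <= row_span A Ij.1)%MS]].

End Polyhedron.

Section ShadowVertex.
Context {R : realType} {n : nat}.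
Implicit Types (P : set 'rV[R]_n) (c w x y : 'rV[R]_n) (s : seq 'rV[R]_n).

Definition shadow c w x : 'rV[R]_2 :=
  \row_(j < 2) (if j == 0 then dot c x else dot w x).

(* [p, q] is an edge of the planar set Q, oriented to the right, such that no
   point of Q lies below the line through p and q. *)
Definition lower_edge (Q : set 'rV[R]_2) (p q : 'rV[R]_2) : Prop :=
  [/\ edge Q p q,
      p 0 0 < q 0 0 &
      forall r, Q r ->
        (q 0 1 - p 0 1) * (r 0 0 - p 0 0) <= (q 0 0 - p 0 0) * (r 0 1 - p 0 1)].

Definition shadow_step P c w x y : Prop :=
  edge P x y /\
  lower_edge (shadow c w @` P) (shadow c w x) (shadow c w y).

(* The path is x0 :: s, so that its number of edges is size s.  It stops as
   soon as a rightmost point is reached, since steps go strictly right. *)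
Definition is_shadow_path P c w x0 s : Prop :=
  path (fun x y => `[< shadow_step P c w x y >]) x0 s /\
  forall r, (shadow c w @` P) r -> r 0 0 <= shadow c w (last x0 s) 0 0.

(* The successive projections of such a path are determined by the lower
   envelope of the shadow, so its length does not depend on the choice. *)
Definition shadow_path P c w x0 : seq 'rV[R]_n :=
  xget [::] [set s | is_shadow_path P c w x0 s].

End ShadowVertex.

Definition mutually_independent {R : realType} (d : measure_display)
    (Omega : measurableType d) (Pr : probability Omega R)
    (I : finType) (X : I -> {RV Pr >-> R}) : Prop :=
  forall (J : {set I}) (B : I -> set R),
    (forall i, measurable (B i)) ->
    Pr (\bigcap_(i in [set` J]) X i @^-1` B i) =
    (\prod_(i in J) Pr (X i @^-1` B i))%E.

Definition sum_family {I J T : Type} (f : I -> T) (g : J -> T)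
    (k : I + J) : T :=
  match k with inl i => f i | inr j => g j end.

(* Main.v *)
(* Write w = - U lambda.  At slope t the path sits at the maximiser of
   t c + U lambda.  Slopes at most n are controlled by the randomness of
   lambda for fixed c, slopes above n by that of c for fixed lambda (sweeping
   the inverse slope).  If an edge with slope in (t, t + e] leaves facet i at a
   vertex x, then x maximises the objective at time t over facet i, so x and the
   edge depend only on that objective modulo a_i; the remaining degree of
   freedom, a translation of the objective along a_i, is confined to an interval
   of length O(e / delta).  Hence the event is disjoint from its translates by
   multiples of a vector v of that size, and for a uniform point of a box such
   an event has probability at most the sum of the |v_i| / len_i.  Summing over
   the facets and over a grid of slopes, and letting e tend to 0 with Fatou's
   lemma, bounds the expected number of edges. *)
Require Import Defs.
From HB Require Import structures.
From mathcomp Require Import all_boot all_order all_algebra.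
From mathcomp Require Import all_classical all_reals all_analysis.
From mathcomp Require Import measurable_realfun ring lra.
Import Order.TTheory GRing.Theory Num.Theory.
Import numFieldNormedType.Exports.
Local Open Scope classical_set_scope.
Local Open Scope ring_scope.
Set Implicit Arguments.
Unset Strict Implicit.
Unset Printing Implicit Defensive.

(** * Translates of events under the uniform law on a box *)

Section UniformTranslation.
Context {R : realType}.

Definition translate (t : R) : measurableTypeR R -> measurableTypeR R :=
  fun y => y - t.

Lemma measurable_translate t : measurable_fun setT (translate t).
Proof. exact: measurable_funB. Qed.

Lemma measurable_translate_preimage t (A : set R) : measurable A ->
  measurable (translate t @^-1` A : set R).
Proof. by rewrite -[X in _ -> measurable X]setTI; exact: measurable_translate. Qed.

HB.instance Definition _ t := @isMeasurableFun.Build _ _ _ _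
  (translate t) (@measurable_translate t).

Lemma lebesgue_measure_translate (t : R) (A : set R) : measurable A ->
  lebesgue_measure (translate t @^-1` A) = lebesgue_measure A.
Proof.
move=> mA; rewrite -[LHS]/(pushforward lebesgue_measure (translate t) A).
apply/esym/lebesgue_measure_unique => //= _ [[a b]] _ <-; rewrite /pushforward.
have -> : translate t @^-1` `]a, b]%classic = `]a + t, b + t]%classic.
  by apply/seteqP; split => y /=; rewrite !in_itv /= ltrBrDr lerBlDr.
rewrite !lebesgue_measure_itv/= !lte_fin ltrD2r; case: ifP => // _.
by rewrite -!EFinD; congr (_%:E); ring.
Qed.

Lemma uniform_probE (a b : R) (ab : a < b) (A : set R) : measurable A ->
  A `<=` `[a, b] ->
  uniform_prob ab A = ((b - a)^-1%:E * lebesgue_measure A)%E.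
Proof.
move=> mA Aab; rewrite /uniform_prob -integral_cst//.
apply: eq_integral => x /set_mem/Aab /=; rewrite in_itv /= => xab.
by rewrite /uniform_pdf xab.
Qed.

Lemma uniform_prob_translate (a b : R) (ab : a < b) t (A : set R) :
  measurable A -> A `<=` `[a, b] -> translate t @^-1` A `<=` `[a, b] ->
  uniform_prob ab (translate t @^-1` A) = uniform_prob ab A.
Proof.
move=> mA Aab tAab; rewrite !uniform_probE//; last first.
  exact: measurable_translate_preimage.
by rewrite lebesgue_measure_translate.
Qed.

Lemma uniform_prob_exit (a b : R) (ab : a < b) t :
  (uniform_prob ab (`[a, b] `\` [set y | (y + t)%R \in `[a, b]]) <=
   (`|t| / (b - a))%:E)%E.
Proof.
have ba : 0 < b - a by rewrite subr_gt0.
have mI : measurable (`[a, b] `\` [set y | (y + t)%R \in `[a, b]]).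
  apply: measurableD => //.
  have -> : [set y | (y + t)%R \in `[a, b]] = `[a - t, b - t]%classic.
    by apply/seteqP; split => y /=; rewrite !in_itv /= lerBlDr lerBrDr.
  by [].
rewrite uniform_probE//.
rewrite (mulrC `|t|) EFinM lee_wpmul2l//; first by rewrite lee_fin invr_ge0 ltW.
have sub (J : set R) : (forall y, y \in `[a, b] -> ~ (y + t)%R \in `[a, b] -> J y) ->
    `[a, b] `\` [set y | (y + t)%R \in `[a, b]] `<=` J.
  by move=> h y [] /=; exact: h.
have [t0|t0] := leP 0 t.
  apply: (@le_trans _ _ (lebesgue_measure `[b - t, b]%classic)).
    rewrite le_measure ?inE//; apply: sub => y /=.
    rewrite !in_itv /= => /andP[ay yb] h; rewrite yb andbT leNgt.
    by apply/negP => yt; apply: h; apply/andP; split; lra.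
  rewrite lebesgue_measure_itv/=; case: ifP => _; last by rewrite lee_fin.
  by rewrite -EFinD lee_fin ger0_norm//; lra.
apply: (@le_trans _ _ (lebesgue_measure `[a, a - t]%classic)).
  rewrite le_measure ?inE//; apply: sub => y /=.
  rewrite !in_itv /= => /andP[ay yb] h; rewrite ay /= leNgt.
  by apply/negP => yt; apply: h; apply/andP; split; lra.
rewrite lebesgue_measure_itv/=; case: ifP => _; last by rewrite lee_fin.
by rewrite -EFinD lee_fin ltr0_norm//; lra.
Qed.

End UniformTranslation.

Section ProductSpace.
Context {R : realType} {I : finType}.

Definition boxes : set (set (I -> R)) :=
  [set B | exists2 S : I -> set R, (forall i, measurable (S i)) &
     B = [set x | forall i, S i (x i)]].

Definition coord_space := g_sigma_algebraType boxes.

HB.instance Definition _ := Measurable.on coord_space.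

Lemma measurable_box (S : I -> set R) : (forall i, measurable (S i)) ->
  measurable ([set x | forall i, S i (x i)] : set coord_space).
Proof. by move=> mS; apply: sub_sigma_algebra; exists S. Qed.

Lemma measurable_coord i :
  measurable_fun setT (fun x : coord_space => x i).
Proof.
move=> _ A mA; rewrite setTI.
have -> : (fun x : coord_space => x i) @^-1` A =
    [set x | forall j, (if j == i then A else setT) (x j)].
  apply/seteqP; split => x /= => [Ax j|/(_ i)]; last by rewrite eqxx.
  by case: eqP => // ->.
by apply: (@measurable_box (fun j => if j == i then A else setT)) => j; case: ifP.
Qed.

Lemma boxes_setI : setI_closed boxes.
Proof.
move=> _ _ [S mS ->] [S' mS' ->]; exists (fun i => S i `&` S' i).
  by move=> i; exact: measurableI.
apply/seteqP; split => x /=; first by move=> [h h'] i; split.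
by move=> h; split=> i; case: (h i).
Qed.

End ProductSpace.

Section ProductTranslation.
Context {R : realType} {I : finType}.
Context (d : measure_display) (Omega : measurableType d)
  (Pr : probability Omega R) (X : I -> {RV Pr >-> R}).
Context (lo hi : I -> R) (lohi : forall i, lo i < hi i).
Hypothesis lawX : forall i (B : set R), measurable B ->
  distribution Pr (X i) B = uniform_prob (lohi i) B.
Hypothesis indX : mutually_independent X.
Local Notation E := (@coord_space R I).

Definition joint (omega : Omega) : E := fun i => X i omega.

Lemma measurable_joint : measurable_fun setT joint.
Proof.
apply: (@measurability _ _ _ E setT _ boxes) => //= _ [_ [S mS ->] <-]; rewrite setTI.
have -> : joint @^-1` [set x | forall i, S i (x i)] =
    \big[setI/setT]_i X i @^-1` S i.
  rewrite -bigcap_seq; apply/seteqP.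
  by split => w /= h i; [move=> _; exact: h|apply: h; rewrite /= mem_index_enum].
by apply: bigsetI_measurable => i _; exact: measurable_funPTI.
Qed.

HB.instance Definition _ := @isMeasurableFun.Build _ _ _ _
  joint measurable_joint.

Lemma joint_box (S : I -> set R) : (forall i, measurable (S i)) ->
  Pr (joint @^-1` [set x | forall i, S i (x i)]) =
  (\prod_i uniform_prob (lohi i) (S i))%E.
Proof.
move=> mS; under eq_bigr do rewrite -lawX//.
rewrite -[LHS](_ : Pr (\bigcap_(i in [set` [set: I]%SET]) X i @^-1` S i) = _).
  by rewrite indX//; apply: eq_bigl => i; rewrite finset.in_setT.
congr (Pr _); apply/seteqP; split => w /= h i.
  by apply: h; rewrite /= finset.in_setT.
by move=> _; exact: h.
Qed.

Definition box : set E := [set x | forall i, x i \in `[lo i, hi i]].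

Definition vtranslate (v : E) : E -> E := fun y i => y i - v i.

Lemma measurable_vtranslate v : measurable_fun setT (vtranslate v).
Proof.
apply: (@measurability _ _ _ E setT _ boxes) => //= _ [_ [S mS ->] <-]; rewrite setTI.
have -> : vtranslate v @^-1` [set x | forall i, S i (x i)] =
    [set x | forall i, (translate (v i) @^-1` S i) (x i)] by [].
apply: (@measurable_box _ _ (fun i => translate (v i) @^-1` S i)) => i.
exact: measurable_translate_preimage.
Qed.

HB.instance Definition _ v := @isMeasurableFun.Build _ _ _ _
  (vtranslate v) (@measurable_vtranslate v).

Lemma joint_translate (v : E) (B : set E) : measurable B ->
  B `<=` box -> vtranslate v @^-1` B `<=` box ->
  Pr (joint @^-1` (vtranslate v @^-1` B)) = Pr (joint @^-1` B).
Proof.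
move=> mB Bbox tBbox.
pose S i : set R := `[lo i, hi i] `&` `[lo i - v i, hi i - v i].
have mS i : measurable (S i) by exact: measurableI.
pose D : set E := [set x | forall i, S i (x i)].
have mD : measurable D by exact: measurable_box.
have BD : B `<=` D.
  move=> x Bx i; split; first exact: Bbox.
  have tx : vtranslate v (fun i => x i + v i) = x.
    by apply/funext => j; rewrite /vtranslate addrK.
  have := tBbox (fun i => x i + v i); rewrite /preimage /= tx => /(_ Bx i) /=.
  by rewrite !in_itv /= lerBrDr lerBlDr.
pose m1 := mrestr (pushforward Pr joint) mD.
pose m2 := mrestr (pushforward (pushforward Pr joint) (vtranslate v)) mD.
suff : m1 B = m2 B by rewrite /m1 /m2 /mrestr /pushforward /= setIidl.
apply: (@measure_unique _ R E boxes (fun=> setT)) => //.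
- exact: boxes_setI.
- move=> _; exists (fun=> setT) => //.
  by apply/seteqP; split.
- by apply/seteqP; split => // x _; exists 0%N.
- move=> _ [T mT ->].
  pose TS : set E := [set x | forall i, (T i `&` S i) (x i)].
  have eTD : ([set x | forall i, T i (x i)] : set E) `&` D = TS.
    apply/seteqP; split => x /=; first by move=> [? ?] i; split.
    by move=> h; split => i; case: (h i).
  suff h : Pr (joint @^-1` TS) = Pr (joint @^-1` (vtranslate v @^-1` TS)).
    by move: h; rewrite -eTD.
  have mTS i : measurable (T i `&` S i) by exact: measurableI.
  have mtTS i := measurable_translate_preimage (v i) (mTS i).
  apply: (etrans (joint_box mTS)); apply: (etrans _ (esym (joint_box mtTS))).
  apply: eq_bigr => i _; rewrite uniform_prob_translate//.
  + by move=> y [_ []].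
  + by move=> y [_ [_]]; rewrite /translate /= !in_itv /=; lra.
- move=> _; rewrite /m1 /mrestr /pushforward; apply: le_lt_trans (ltry 1%R).
  by apply: probability_le1; apply: measurable_funPTI; exact: measurableI.
Qed.

End ProductTranslation.

Lemma measure_finite_subadditive (d : measure_display) (T : measurableType d)
    (R : realType) (mu : {measure set T -> \bar R}) (I : finType)
    (A : set T) (F : I -> set T) : measurable A -> (forall i, measurable (F i)) ->
  (forall x, A x -> exists i, F i x) -> (mu A <= \sum_i mu (F i))%E.
Proof.
move=> mA mF sAF; have mU (r : seq I) : measurable (\big[setU/set0]_(i <- r) F i).
  exact: bigsetU_measurable.
apply: (@le_trans _ _ (mu (\big[setU/set0]_i F i))).
  rewrite le_measure ?inE// => x /sAF[i Fix].
  by rewrite -bigcup_seq; exists i; rewrite //= mem_index_enum.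
elim: (index_enum I) => [|i r ih]; first by rewrite !big_nil measure0.
rewrite !big_cons; apply: le_trans (measureU2 _ _ _) _ => //.
exact: leeD2l.
Qed.

Section TranslationBound.
Context {R : realType} {I : finType}.
Context (d : measure_display) (Omega : measurableType d)
  (Pr : probability Omega R) (X : I -> {RV Pr >-> R}).
Context (lo hi : I -> R) (lohi : forall i, lo i < hi i).
Hypothesis lawX : forall i (B : set R), measurable B ->
  distribution Pr (X i) B = uniform_prob (lohi i) B.
Hypothesis indX : mutually_independent X.
Local Notation E := (@coord_space R I).
Local Notation Q := (box lo hi).
Local Notation J := (joint X).

Lemma measurable_Q : measurable (Q : set E).
Proof. by apply: (@measurable_box _ _ (fun i => `[lo i, hi i]%classic)). Qed.

Lemma measurable_joint_preimage (B : set E) : measurable B ->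
  measurable (J @^-1` B).
Proof. by move=> mB; rewrite -[X in measurable X]setTI; exact: measurable_joint. Qed.

Lemma measurable_vtranslate_preimage (v : E) (B : set E) : measurable B ->
  measurable (vtranslate v @^-1` B).
Proof.
by move=> mB; rewrite -[X in measurable X]setTI; exact: measurable_vtranslate.
Qed.

Lemma joint_box_ae : Pr (J @^-1` Q) = 1%E.
Proof.
rewrite [LHS](joint_box lawX indX (S := fun i => `[lo i, hi i]%classic))//.
rewrite big1// => i _; rewrite /uniform_prob integral_uniform_pdf1//.
Qed.

Lemma joint_setI_box (B : set E) : measurable B ->
  Pr (J @^-1` B) = Pr (J @^-1` (B `&` Q)).
Proof.
move=> mB; have mQ := measurable_joint_preimage measurable_Q.
have mJB := measurable_joint_preimage mB.
rewrite preimage_setI; apply/eqP; rewrite eq_le; apply/andP; split; last first.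
  by rewrite le_measure ?inE//; exact: measurableI.
rewrite -[X in (Pr X <= _)%E](setUIDK _ (J @^-1` Q)).
apply: le_trans (measureU2 _ _ _) _; first exact: measurableI.
  exact: measurableD.
rewrite [X in (_ + X)%E](_ : _ = 0%E) ?adde0//.
apply/eqP; rewrite -measure_le0; apply: (@le_trans _ _ (Pr (~` (J @^-1` Q)))).
  by rewrite le_measure ?inE//; [exact: measurableD|exact: measurableC].
by rewrite probability_setC// joint_box_ae subee.
Qed.

Definition exit_layer (v : E) : set E := Q `\` (vtranslate (fun i => - v i) @^-1` Q).

Lemma prob_exit (v : E) :
  (Pr (J @^-1` exit_layer v) <= (\sum_i `|v i| / (hi i - lo i))%:E)%E.
Proof.
have mexit : measurable (exit_layer v).
  apply: measurableD; first exact: measurable_Q.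
  exact: measurable_vtranslate_preimage measurable_Q.
pose F i : set R := `[lo i, hi i] `\` [set y | y + v i \in `[lo i, hi i]].
have mF i : measurable (F i).
  apply: measurableD => //.
  have -> : [set y | y + v i \in `[lo i, hi i]] = `[lo i - v i, hi i - v i]%classic.
    by apply/seteqP; split => y /=; rewrite !in_itv /= lerBlDr lerBrDr.
  by [].
have mXF i : measurable (X i @^-1` F i) by exact: measurable_funPTI.
apply: (@le_trans _ _ (\sum_i Pr (X i @^-1` F i))%E).
  apply: measure_finite_subadditive => //; first exact: measurable_joint_preimage.
  move=> w [Qw nQw]; apply: contrapT => h; apply: nQw => i.
  rewrite /vtranslate /= opprK; apply: contrapT => nQi; apply: h; exists i.
  by split => //; exact: Qw.
rewrite -sumEFin; apply: lee_sum => i _.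
have := lawX i (mF i); rewrite /distribution /pushforward => ->.
exact: uniform_prob_exit.
Qed.

(* Push every point of B along v until its last position inside the box: this
   is injective on B, preserves the law, and ends in the exit layer. *)
Lemma prob_disjoint_translates (B : set E) (v : E) : measurable B ->
  (forall (j : nat) x, B x -> Q x -> B (fun i => x i + v i *+ j.+1) ->
    Q (fun i => x i + v i *+ j.+1) -> False) ->
  (Pr (J @^-1` B) <= (\sum_i `|v i| / (hi i - lo i))%:E)%E.
Proof.
move=> mB disj; rewrite joint_setI_box//.
pose w j : E := fun i => - (v i *+ j).
have wE j x : vtranslate (w j) x = fun i => x i + v i *+ j.
  by apply/funext => i; rewrite /vtranslate /w opprK.
pose A j : set E := B `&` Q `&` (vtranslate (w j) @^-1` exit_layer v).
have mexit : measurable (exit_layer v).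
  apply: measurableD; first exact: measurable_Q.
  exact: measurable_vtranslate_preimage measurable_Q.
have mBQ : measurable (B `&` Q) by apply: measurableI => //; exact: measurable_Q.
have mA j : measurable (A j).
  by apply: measurableI => //; exact: measurable_vtranslate_preimage.
have [N coverA] : exists N, forall x, B x -> Q x -> exists j : 'I_N, A j x.
  have [v0|] := pselect (forall i, v i = 0).
    exists 0%N => x Bx Qx; exfalso; apply: (disj 0%N x) => //.
      by rewrite (_ : (fun i => _) = x)//; apply/funext => i; rewrite v0 mul0rn addr0.
    by rewrite (_ : (fun i => _) = x)//; apply/funext => i; rewrite v0 mul0rn addr0.
  move=> /existsNP[i /eqP vi0].
  pose N := (Num.bound ((hi i - lo i) / `|v i|)).+1.
  exists N => x Bx Qx.
  have bN j : `[< Q (fun i => x i + v i *+ j) >] -> (j <= N.-1)%N.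
    move=> /asboolP Qj; rewrite /N /=; apply: ltnW.
    have vi_gt0 : 0 < `|v i| by rewrite normr_gt0.
    have : j%:R <= (hi i - lo i) / `|v i|.
      rewrite ler_pdivlMr// -[j%:R]ger0_norm ?ler0n// -normrM mulr_natl.
      have := Qj i; have := Qx i; rewrite !in_itv /= ler_norml; lra.
    move=> /le_lt_trans; rewrite -(ltr_nat R); apply.
    by apply: archi_boundP; rewrite divr_ge0// subr_ge0 ltW.
  have ex0 : exists j, `[< Q (fun i => x i + v i *+ j) >].
    exists 0%N; apply/asboolP; rewrite (_ : (fun i => _) = x)//.
    by apply/funext => k; rewrite mulr0n addr0.
  case: (ex_maxnP ex0 bN) => j /asboolP Qj maxj.
  have jN : (j < N)%N by rewrite ltnS; apply: bN; apply/asboolP.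
  exists (Ordinal jN); split => //; rewrite /exit_layer /preimage /=; split.
    by rewrite wE.
  rewrite wE => Qj1; suff : (j.+1 <= j)%N by rewrite ltnn.
  apply: maxj; apply/asboolP.
  rewrite (_ : (fun k => _) = vtranslate (fun k => - v k)
    (fun k => x k + v k *+ j))//.
  by apply/funext => k; rewrite /vtranslate opprK mulrSr addrA.
pose L j := vtranslate (fun i => v i *+ j) @^-1` A j.
have LE j y : L j y -> [/\ B (fun i => y i - v i *+ j), Q (fun i => y i - v i *+ j)
    & exit_layer v y].
  move=> [[By Qy]]; rewrite /preimage /= wE => ey; split => //.
  rewrite (_ : y = fun i => vtranslate (fun i => v i *+ j) y i + v i *+ j)//.
  by apply/funext => i; rewrite /vtranslate subrK.
have mL j : measurable (L j) by exact: measurable_vtranslate_preimage.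
apply: (@le_trans _ _ (\sum_(j < N) Pr (J @^-1` A j))%E).
  apply: measure_finite_subadditive => //.
  - exact: measurable_joint_preimage.
  - by move=> j; exact: measurable_joint_preimage.
  - by move=> om [? ?]; apply: coverA.
have -> : (\sum_(j < N) Pr (J @^-1` A j) = \sum_(j < N) Pr (J @^-1` L j))%E.
  apply: eq_bigr => j _; apply/esym; apply: (joint_translate lawX indX) => //.
  - by move=> x [[]].
  - by move=> y /LE[_ _ []].
rewrite -measure_bigsetU_ord; last 2 first.
- by move=> j; exact: measurable_joint_preimage.
- move=> j k _ _ [om [/LE[Bj Qj _] /LE[Bk Qk _]]].
  have noorder (a b : nat) : (a < b)%N ->
      B (fun i => J om i - v i *+ a) -> Q (fun i => J om i - v i *+ a) ->
      B (fun i => J om i - v i *+ b) -> Q (fun i => J om i - v i *+ b) -> False.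
    move=> ab Ba Qa Bb Qb.
    have e : (fun i => J om i - v i *+ a) =
        fun i => J om i - v i *+ b + v i *+ (b - a).-1.+1.
      apply/funext => i; rewrite prednK ?subn_gt0// mulrnBr 1?ltnW//.
      by rewrite addrA subrK.
    by apply: (disj (b - a).-1 _ Bb Qb); rewrite -e.
  apply/val_inj => /=; case: (ltngtP j k) => // jk; exfalso.
    exact: noorder jk _ _ _ _.
  exact: noorder jk _ _ _ _.
apply: le_trans (prob_exit v); rewrite le_measure ?inE//.
- by apply: bigsetU_measurable => j _; exact: measurable_joint_preimage.
- exact: measurable_joint_preimage.
- by move=> om; rewrite -bigcup_seq => -[j _ /LE[]].
Qed.

Lemma null_disjoint_translates (B : set E) (v : E) : measurable B ->
  (forall (t : R) x, 0 < t -> B x -> B (fun i => x i + t * v i) -> False) ->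
  Pr (J @^-1` B) = 0%E.
Proof.
move=> mB disj; apply/eqP; rewrite -measure_le0; apply/lee_addgt0Pr => e e0.
rewrite add0e; pose S := \sum_i `|v i| / (hi i - lo i).
have S0 : 0 <= S.
  by apply: sumr_ge0 => i _; rewrite divr_ge0// subr_ge0 ltW.
pose t := e / (S + 1); have t0 : 0 < t by rewrite divr_gt0// ltr_wpDl.
apply: le_trans (prob_disjoint_translates (v := fun i => t * v i) mB _) _.
  move=> j x Bx _ Bxv _; apply: (disj (t *+ j.+1) x) => //.
    by rewrite pmulrn_lgt0.
  by under eq_fun do rewrite mulrnAl.
rewrite lee_fin (eq_bigr (fun i => t * (`|v i| / (hi i - lo i)))); last first.
  by move=> i _; rewrite normrM (gtr0_norm t0) mulrA.
have S1 : 0 < S + 1 by rewrite ltr_wpDl.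
rewrite -mulr_sumr -/S /t mulrAC ler_pdivrMr// ler_wpM2l ?ltW//.
by rewrite ltrDl.
Qed.

End TranslationBound.

(** * Edge directions at a vertex *)

Section DotProduct.
Context {R : realType} {n : nat}.
Implicit Types (u v z : 'rV[R]_n).

Lemma dotE u v : dot u v = (u *m v^T) 0 0.
Proof. by rewrite mxE; apply: eq_bigr => i _; rewrite mxE. Qed.

Lemma dotC u v : dot u v = dot v u.
Proof. by apply: eq_bigr => i _; rewrite mulrC. Qed.

Lemma dotDl u v z : dot (u + v) z = dot u z + dot v z.
Proof. by rewrite !dotE mulmxDl mxE. Qed.

Lemma dotZl k u z : dot (k *: u) z = k * dot u z.
Proof. by rewrite !dotE -scalemxAl mxE. Qed.

Lemma dotNl u z : dot (- u) z = - dot u z.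
Proof. by rewrite !dotE mulNmx mxE. Qed.

Lemma dotBl u v z : dot (u - v) z = dot u z - dot v z.
Proof. by rewrite dotDl dotNl. Qed.

Lemma dot0l z : dot 0 z = 0.
Proof. by rewrite dotE mul0mx mxE. Qed.

Lemma dot_suml (I : Type) (r : seq I) (P : pred I) (F : I -> 'rV[R]_n) z :
  dot (\sum_(i <- r | P i) F i) z = \sum_(i <- r | P i) dot (F i) z.
Proof. by rewrite dotE mulmx_suml summxE; apply: eq_bigr => i _; rewrite dotE. Qed.

Lemma dotDr u v z : dot z (u + v) = dot z u + dot z v.
Proof. by rewrite !(dotC z) dotDl. Qed.

Lemma dotZr k u z : dot z (k *: u) = k * dot z u.
Proof. by rewrite !(dotC z) dotZl. Qed.

Lemma dotNr u z : dot z (- u) = - dot z u.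
Proof. by rewrite !(dotC z) dotNl. Qed.

Lemma dotBr u v z : dot z (u - v) = dot z u - dot z v.
Proof. by rewrite dotDr dotNr. Qed.

Lemma dot0r z : dot z 0 = 0.
Proof. by rewrite dotC dot0l. Qed.

Lemma dot_sumr (I : Type) (r : seq I) (P : pred I) (F : I -> 'rV[R]_n) z :
  dot z (\sum_(i <- r | P i) F i) = \sum_(i <- r | P i) dot z (F i).
Proof. by rewrite dotC dot_suml; apply: eq_bigr => i _; rewrite dotC. Qed.

Lemma dotvv_ge0 u : 0 <= dot u u.
Proof. by apply: sumr_ge0 => i _; rewrite -expr2 sqr_ge0. Qed.

Lemma dotvv_eq0 u : (dot u u == 0) = (u == 0).
Proof.
apply/idP/eqP => [|->]; last by rewrite dot0l.
rewrite psumr_eq0 => [/allP h|i _]; last by rewrite -expr2 sqr_ge0.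
apply/rowP => i; rewrite mxE; apply/eqP.
by have := h i (mem_index_enum i); rewrite mulf_eq0 orbb.
Qed.

Lemma enorm_ge0 u : 0 <= enorm u.
Proof. exact: sqrtr_ge0. Qed.

Lemma enorm_sqr u : enorm u ^+ 2 = dot u u.
Proof. by rewrite sqr_sqrtr// dotvv_ge0. Qed.

Lemma enormZ k u : enorm (k *: u) = `|k| * enorm u.
Proof. by rewrite /enorm dotZl dotZr mulrA -expr2 sqrtrM ?sqr_ge0// sqrtr_sqr. Qed.

Lemma enormN u : enorm (- u) = enorm u.
Proof. by rewrite /enorm dotNl dotNr opprK. Qed.

Lemma enorm_eq0 u : (enorm u == 0) = (u == 0).
Proof. by rewrite -sqrf_eq0 enorm_sqr dotvv_eq0. Qed.

Lemma cauchy_schwarz u v : `|dot u v| <= enorm u * enorm v.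
Proof.
rewrite -ler_sqr ?nnegrE ?mulr_ge0 ?enorm_ge0// real_normK ?num_real// exprMn !enorm_sqr.
have [->|v0] := eqVneq v 0; first by rewrite !dot0r mulr0 expr0n.
have vv : 0 < dot v v by rewrite lt_def dotvv_eq0 v0 dotvv_ge0.
have := dotvv_ge0 (dot v v *: u - dot u v *: v).
rewrite !dotBl !dotBr !dotZl !dotZr (dotC v u) => h.
by rewrite -subr_ge0 -(pmulr_rge0 _ vv); lra.
Qed.

Lemma ler_enormD u v : enorm (u + v) <= enorm u + enorm v.
Proof.
rewrite -ler_sqr ?nnegrE ?addr_ge0 ?enorm_ge0// sqrrD !enorm_sqr.
rewrite dotDl !dotDr (dotC v u); have := cauchy_schwarz u v.
by move=> /(le_trans (ler_norm _)); lra.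
Qed.

Lemma ler_enorm_sum (I : Type) (r : seq I) (P : pred I) (F : I -> 'rV[R]_n) :
  enorm (\sum_(i <- r | P i) F i) <= \sum_(i <- r | P i) enorm (F i).
Proof.
elim/big_rec2: _ => [|i y x _ h]; first by rewrite /enorm dot0l sqrtr0.
by apply: le_trans (ler_enormD _ _) _; rewrite lerD2l.
Qed.

Lemma l1_le_enorm u : \sum_i `|u 0 i| <= Num.sqrt n%:R * enorm u.
Proof.
pose s : 'rV[R]_n := const_mx 1; pose a : 'rV[R]_n := \row_i `|u 0 i|.
have -> : \sum_i `|u 0 i| = dot s a.
  by apply: eq_bigr => i _; rewrite !mxE mul1r.
apply: le_trans (ler_norm _) _; apply: le_trans (cauchy_schwarz _ _) _.
rewrite /enorm (_ : dot s s = n%:R); last first.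
  by rewrite /dot (eq_bigr (fun=> 1)) ?sumr_const ?card_ord// => i _; rewrite !mxE mulr1.
rewrite (_ : dot a a = dot u u)//; apply: eq_bigr => i _.
by rewrite !mxE -normrM ger0_norm// -expr2 sqr_ge0.
Qed.

Lemma enorm_le_sqrt u (e : R) : 0 <= e -> (forall i, `|u 0 i| <= e) ->
  enorm u <= Num.sqrt n%:R * e.
Proof.
move=> e0 ue; rewrite -ler_sqr ?nnegrE ?mulr_ge0 ?enorm_ge0 ?sqrtr_ge0//.
rewrite enorm_sqr exprMn sqr_sqrtr ?ler0n// mulr_natl.
rewrite -[X in _ *+ X]card_ord -sumr_const; apply: ler_sum => i _.
by rewrite -expr2 -[u 0 i ^+ 2]real_normK ?num_real// lerXn2r// ?nnegrE.
Qed.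

End DotProduct.

Section DistSpan.
Context {R : realType} {n : nat}.
Implicit Types (u v z : 'rV[R]_n) (U : 'M[R]_n).

Lemma dist_span_le v U y : (y <= U)%MS -> dist_span v U <= enorm (v - y).
Proof.
move=> yU; apply: ge_inf; last by exists y.
by exists 0 => _ [z _ <-]; exact: enorm_ge0.
Qed.

Lemma dist_span_gt0 v U : ~~ (v <= U)%MS -> 0 < dist_span v U.
Proof.
rewrite submxE => /eqP vU.
have [j vj] : exists j, (v *m cokermx U) 0 j != 0.
  apply: contrapT => /forallNP h; apply: vU; apply/rowP => j; rewrite [RHS]mxE.
  by apply/eqP/negPn/negP; exact: h.
pose z : 'rV[R]_n := (col j (cokermx U))^T.
have dotz y : dot y z = (y *m cokermx U) 0 j.
  by rewrite dotE trmxK mxE [RHS]mxE; apply: eq_bigr => i _; rewrite mxE.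
have z0 : 0 < enorm z.
  rewrite lt_def enorm_ge0 andbT enorm_eq0; apply: contraNneq vj => z0.
  by rewrite -dotz z0 dot0r.
apply: (@lt_le_trans _ _ (`|dot v z| / enorm z)).
  by rewrite divr_gt0// normr_gt0 dotz.
apply: lb_le_inf; first by exists (enorm (v - 0)); exists 0 => //=; exact: sub0mx.
move=> _ [y /= yU <-]; rewrite ler_pdivrMr//.
have -> : dot v z = dot (v - y) z; last exact: cauchy_schwarz.
rewrite dotBl [dot y z]dotz; move: yU; rewrite submxE => /eqP ->.
by rewrite mxE subr0.
Qed.

End DistSpan.

Section DeltaBounds.
Context {R : realType} {m n : nat} (A : 'M[R]_(m, n)).

Lemma delta_gt0 (i : 'I_m) : row i A != 0 -> 0 < delta A.
Proof.
move=> ai0; pose good (Ij : {set 'I_m} * 'I_m) :=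
  ~~ (row Ij.2 A <= row_span A Ij.1)%MS.
pose mu := \big[Order.min/1]_(Ij | good Ij) dist_span (row Ij.2 A) (row_span A Ij.1).
have mu0 : 0 < mu.
  rewrite /mu; elim/big_ind: _ => //.
    by move=> x y x0 y0; rewrite lt_min x0 y0.
  by move=> Ij; exact: dist_span_gt0.
apply: lt_le_trans mu0 _; apply: lb_le_inf.
  exists (dist_span (row i A) (row_span A finset.set0)).
  by exists (finset.set0, i) => //=; rewrite /row_span big_set0 submx0.
move=> _ [Ij /= gIj <-]; rewrite /mu.
exact: (bigmin_le_cond (P := good) _ (fun Ij =>
  dist_span (row Ij.2 A) (row_span A Ij.1)) gIj).
Qed.

Lemma delta_le (J : {set 'I_m}) (i : 'I_m) : ~~ (row i A <= row_span A J)%MS ->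
  delta A <= dist_span (row i A) (row_span A J).
Proof.
move=> iJ; apply: ge_inf; last by exists (J, i).
by exists 0 => _ [Ij /= gIj <-]; apply: ltW; exact: dist_span_gt0.
Qed.

End DeltaBounds.

Section Rays.
Context {R : realType} {m n : nat} (A : 'M[R]_(m, n)).
Implicit Types (T : {set 'I_m}) (y z : 'rV[R]_n).
Local Notation a i := (row i A).

Definition basis_set T : Prop :=
  #|T| = n /\ row_free (rowsub (fun k : 'I_#|T| => enum_val k) A).

(* The rays are minus the basis dual to the rows in T: at a vertex with tight
   set T they are the directions of the edges, ray T k leaving facet k. *)
Definition ray T (k : 'I_m) : 'rV[R]_n :=
  xget 0 [set z | forall j, j \in T -> dot (a j) z = - (j == k)%:R].

Lemma rayP T k j : basis_set T -> k \in T -> j \in T ->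
  dot (a j) (ray T k) = - (j == k)%:R.
Proof.
move=> [_ /row_freeP[N MN]] kT jT; move: j jT; rewrite /ray.
set S := [set z | _]; suff [z Sz] : S !=set0 by exact: (xgetI 0 Sz).
exists (- (col (enum_rank_in kT k) N)^T) => j jT.
rewrite dotNr; congr (- _); rewrite dotE trmxK.
have /matrixP/(_ (enum_rank_in kT j) (enum_rank_in kT k)) := MN.
rewrite !mxE => e; have -> : (j == k) = (enum_rank_in kT j == enum_rank_in kT k).
  apply/eqP/eqP => [->//|h].
  by rewrite -(enum_rankK_in kT jT) h enum_rankK_in.
rewrite -e; apply: eq_bigr => i _; rewrite !mxE; congr (A _ _ * _).
by rewrite enum_rankK_in.
Qed.

Lemma basis_span T y : basis_set T ->
  exists g : 'I_m -> R, y = \sum_(k in T) g k *: a k.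
Proof.
move=> [Tn free]; have /row_fullP[B BM] : row_full (rowsub (fun k : 'I_#|T| => enum_val k) A).
  by move: free; rewrite /row_free /row_full => /eqP ->; exact/eqP.
pose g k := oapp (fun j : 'I_#|T| => (y *m B) 0 j) 0 (insub (index k (enum T))).
exists g; rewrite big_enum_val /= -[LHS]mulmx1 -BM mulmxA mulmx_sum_row.
apply: eq_bigr => i _; rewrite row_rowsub; congr (_ *: _).
by rewrite /g index_uniq ?enum_uniq -?cardE//= valK.
Qed.

Lemma basis_dot_eq0 T z : basis_set T ->
  (forall j, j \in T -> dot (a j) z = 0) -> z = 0.
Proof.
move=> bT h; have [g zg] := basis_span z bT.
apply/eqP; rewrite -dotvv_eq0 {1}zg dot_suml big1// => k kT.
by rewrite dotZl h// mulr0.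
Qed.

Lemma ray_expand T z : basis_set T ->
  z = - \sum_(k in T) dot (a k) z *: ray T k.
Proof.
move=> bT; apply/eqP; rewrite -addr_eq0; apply/eqP.
apply: (basis_dot_eq0 bT) => j jT; rewrite dotDr dot_sumr (bigD1 j)//=.
rewrite dotZr rayP// eqxx big1 => [|k /andP[kT kj]]; first by rewrite mulrN1 addr0 subrr.
by rewrite dotZr rayP// eq_sym (negbTE kj) oppr0 mulr0.
Qed.

Lemma row_expand T y : basis_set T ->
  y = - \sum_(k in T) dot y (ray T k) *: a k.
Proof.
move=> bT; have [g yg] := basis_span y bT; rewrite {1}yg -sumrN.
apply: eq_bigr => k kT; rewrite yg dot_suml (bigD1 k)//= dotZl rayP// eqxx.
rewrite big1 ?addr0 ?mulrN1 ?scaleNr ?opprK// => j /andP[jT jk].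
by rewrite dotZl rayP// (negbTE jk) oppr0 mulr0.
Qed.

Lemma ray_neq0 T k : basis_set T -> k \in T -> ray T k != 0.
Proof.
move=> bT kT; apply/eqP => r0; have := rayP bT kT kT.
by rewrite r0 dot0r eqxx => /eqP; rewrite eq_sym oppr_eq0 oner_eq0.
Qed.

(* The point of span(T \ k) nearest to row k is row k + r / |r|^2. *)
Lemma delta_ray T k : basis_set T -> k \in T -> delta A * enorm (ray T k) <= 1.
Proof.
move=> bT kT; set r := ray T k; have r0 := ray_neq0 bT kT.
have nr0 : 0 < enorm r by rewrite lt_def enorm_eq0 r0 enorm_ge0.
rewrite -ler_pdivlMr//; pose J := T :\ k.
have dot_span y : (y <= row_span A J)%MS -> dot y r = 0.
  move=> yJ; have : (y <= kermx r^T)%MS.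
    apply: submx_trans yJ _; apply/sumsmx_subP => j; rewrite !inE => /andP[jk jT].
    rewrite genmxE; apply/sub_kermxP; apply/matrixP => p q.
    by rewrite !ord1 -dotE rayP// (negbTE jk) oppr0 mxE.
  by move/sub_kermxP => e; rewrite dotE e mxE.
apply: le_trans (delta_le (J := J) (i := k) _) _.
  by apply/negP => /dot_span; rewrite rayP// eqxx => /eqP; rewrite oppr_eq0 oner_eq0.
have -> : 1 / enorm r = enorm (a k - (a k + (dot r r)^-1 *: r)).
  rewrite opprD addNKr enormN enormZ -enorm_sqr gtr0_norm ?invr_gt0 ?exprn_gt0//.
  by rewrite expr2 invfM -mulrA mulVf ?gt_eqF// mulr1 div1r.
apply: dist_span_le; set y := (_ + _).
rewrite (row_expand y bT) -scaleN1r; apply/scalemx_sub/summx_sub => j jT.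
have [->|jk] := eqVneq j k.
  rewrite dotDl dotZl rayP// eqxx mulVf ?dotvv_eq0// addNr scale0r; exact: sub0mx.
apply/scalemx_sub; apply: (sumsmx_sup j); first by rewrite !inE jk.
by rewrite genmxE.
Qed.

Lemma enorm_ray T k : (exists i, a i != 0) -> basis_set T -> k \in T ->
  enorm (ray T k) <= (delta A)^-1.
Proof.
move=> [i ai] bT kT; have d0 := delta_gt0 ai.
by rewrite -div1r ler_pdivlMr// mulrC; exact: delta_ray.
Qed.

End Rays.

Section Polytope.
Context {R : realType} {m n : nat} (A : 'M[R]_(m, n)) (b : 'cV[R]_m).
Hypothesis P_bounded : bounded_set (polyhedron A b).
Hypothesis P_nondeg : nondegenerate_polyhedron A b.
Implicit Types (T : {set 'I_m}) (x y g : 'rV[R]_n).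
Local Notation P := (polyhedron A b).
Local Notation a i := (row i A).
Local Notation T_ x := (tight A b x).
Local Notation ray := (ray A).

Lemma vertex_basis x : vertex P x -> basis_set A (T_ x).
Proof. by move=> /P_nondeg. Qed.

Lemma face_mem (F : set 'rV[R]_n) x : face P F -> F x -> P x.
Proof. by move=> [l ->] []. Qed.

Lemma vertex_mem x : vertex P x -> P x.
Proof. by move=> /face_mem; exact. Qed.

Lemma tightP x i : (i \in T_ x) = (dot (a i) x == b i 0).
Proof. by rewrite inE. Qed.

Lemma vertex_diff x y : vertex P x ->
  y - x = \sum_(k in T_ x) (b k 0 - dot (a k) y) *: ray (T_ x) k.
Proof.
move=> vx; rewrite (ray_expand (y - x) (vertex_basis vx)) -sumrN.
apply: eq_bigr => k; rewrite tightP => /eqP kx.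
by rewrite dotBr kx -scaleNr opprB.
Qed.

Lemma dot_vertex_diff x y g : vertex P x ->
  dot g y - dot g x = \sum_(k in T_ x) (b k 0 - dot (a k) y) * dot g (ray (T_ x) k).
Proof.
move=> vx; rewrite -dotBr (vertex_diff y vx) dot_sumr.
by apply: eq_bigr => k _; rewrite dotZr.
Qed.

Lemma rays_le_opt x y g : vertex P x ->
  (forall k, k \in T_ x -> dot g (ray (T_ x) k) <= 0) -> P y -> dot g y <= dot g x.
Proof.
move=> vx gr Py; rewrite -subr_le0 dot_vertex_diff//.
apply: sumr_le0 => k kT; rewrite mulr_ge0_le0 ?gr// subr_ge0; exact: Py.
Qed.

Lemma opt_slack x y g k : vertex P x ->
  (forall k, k \in T_ x -> dot g (ray (T_ x) k) <= 0) -> P y ->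
  dot g x <= dot g y -> k \in T_ x -> dot g (ray (T_ x) k) < 0 ->
  dot (a k) y = b k 0.
Proof.
move=> vx gr Py gxy kT gk.
have h : \sum_(k in T_ x) - ((b k 0 - dot (a k) y) * dot g (ray (T_ x) k)) == 0.
  rewrite sumrN -dot_vertex_diff// oppr_eq0 subr_eq0 eq_le gxy andbT.
  exact: rays_le_opt.
have {h} : - ((b k 0 - dot (a k) y) * dot g (ray (T_ x) k)) == 0.
  move: h; rewrite psumr_eq0 => [/allP/(_ k (mem_index_enum k))/implyP|i iT].
    exact.
  rewrite oppr_ge0 mulr_ge0_le0 ?gr// subr_ge0; exact: Py.
by rewrite oppr_eq0 mulf_eq0 (lt_eqF gk) orbF subr_eq0 => /eqP.
Qed.

Lemma rays_lt_opt x y g : vertex P x ->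
  (forall k, k \in T_ x -> dot g (ray (T_ x) k) < 0) -> P y ->
  dot g x <= dot g y -> y = x.
Proof.
move=> vx gr Py gxy; apply/eqP; rewrite -subr_eq0 (vertex_diff y vx).
rewrite big1// => k kT; rewrite (opt_slack vx _ Py gxy kT) ?gr ?subrr ?scale0r//.
by move=> j jT; apply/ltW/gr.
Qed.

Lemma vertex_tight_inj x y : vertex P x -> T_ x = T_ y -> x = y.
Proof.
move=> vx xy; apply/eqP; rewrite eq_sym -subr_eq0 (vertex_diff y vx).
rewrite big1// => k; rewrite xy tightP => /eqP ->.
by rewrite subrr scale0r.
Qed.

Lemma ray_unbounded x r : r != 0 -> ~ (forall t : R, 0 <= t -> P (x + t *: r)).
Proof.
move=> r0 h; have [M [_ hM]] := P_bounded.
have {}hM := hM (`|M| + 1) _; have Mlt : M < `|M| + 1.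
  by rewrite (le_lt_trans (ler_norm M))// ltrDl.
have nr : 0 < `|r| by rewrite normr_gt0.
pose t := (`|M| + 1 + `|x| + 1) / `|r|.
have t0 : 0 <= t by rewrite divr_ge0// !addr_ge0.
have /= := hM Mlt _ (h t t0).
have : `|t *: r| <= `|x + t *: r| + `|x|.
  rewrite -[X in `|X| <= _](_ : (x + t *: r) - x = _); first exact: ler_normB.
  by rewrite addrC addKr.
rewrite normrZ (ger0_norm t0) /t divfK ?gt_eqF//; lra.
Qed.

Lemma dot_step x r i (t : R) : dot (a i) (x + t *: r) = dot (a i) x + t * dot (a i) r.
Proof. by rewrite dotDr dotZr. Qed.

Lemma vertex_step x k : vertex P x -> k \in T_ x ->
  exists2 t : R, 0 < t & vertex P (x + t *: ray (T_ x) k) /\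
    forall s, P (x + s *: ray (T_ x) k) <-> 0 <= s <= t.
Proof.
move=> vx kT; have bT := vertex_basis vx; set r := ray (T_ x) k.
have Px := vertex_mem vx.
pose F j := 0 < dot (a j) r; pose f j := (b j 0 - dot (a j) x) / dot (a j) r.
have [j0 Fj0] : exists j, F j.
  apply: contrapT => /forallNP h; apply: (@ray_unbounded x r (ray_neq0 bT kT)).
  move=> s s0 i; rewrite dot_step; apply: le_trans (Px i).
  rewrite gerDl mulr_ge0_le0// leNgt; apply/negP; exact: h.
case: (Order.TotalTheory.arg_minP f Fj0) => j Fj minj.
have PxP s : P (x + s *: r) <-> 0 <= s <= f j.
  split=> [Ps|/andP[s0 sf] i].
    have := Ps k; rewrite dot_step rayP// eqxx mulrN1.
    have := kT; rewrite tightP => /eqP ->; rewrite gerDl oppr_le0 => -> /=.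
    by rewrite /f ler_pdivlMr// lerBrDl -dot_step; exact: Ps.
  rewrite dot_step -lerBrDl; have [Fi|Fi] := ltP 0 (dot (a i) r).
    by rewrite -ler_pdivlMr//; apply: le_trans sf _; exact: minj.
  by apply: (@le_trans _ _ 0); [rewrite mulr_ge0_le0|rewrite subr_ge0; exact: Px].
have jT : j \notin T_ x.
  apply/negP => jT; move: Fj; rewrite /F rayP// oppr_gt0.
  by case: (j == k); rewrite ?ltr10 ?ltxx.
exists (f j).
  rewrite divr_gt0// subr_gt0 lt_neqAle; move: jT; rewrite tightP => -> /=.
  exact: Px.
split=> //; set y := x + _.
have fj0 : 0 <= f j by apply: divr_ge0; [rewrite subr_ge0; exact: Px|exact: ltW].
have Py : P y by apply/PxP; rewrite fj0 lexx.
exists (\sum_(i in T_ y) a i); apply/seteqP; split => [_ -> /=|q [Pq qmax] /=].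
  split=> // q Pq; rewrite !dot_suml; apply: ler_sum => i; rewrite tightP => /eqP ->.
  exact: Pq.
have tq i : i \in T_ y -> dot (a i) (q - y) = 0.
  move=> iT; have : \sum_(i in T_ y) (b i 0 - dot (a i) q) == 0.
    rewrite eq_le sumr_ge0 ?andbT => [|l _]; last by rewrite subr_ge0; exact: Pq.
    have := qmax _ Py; rewrite !dot_suml -subr_ge0 -oppr_le0 -sumrB -sumrN.
    congr (_ <= 0); apply: eq_bigr => l; rewrite tightP => /eqP ->; ring.
  rewrite psumr_eq0 => [/allP/(_ i (mem_index_enum i))/implyP/(_ iT)|l _].
    rewrite subr_eq0 => /eqP e; rewrite dotBr -e.
    by move: iT; rewrite tightP => /eqP ->; rewrite subrr.
  by rewrite subr_ge0; exact: Pq.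
have Ty i : i \in T_ x -> i != k -> i \in T_ y.
  move=> iT ik; rewrite tightP dot_step rayP// (negbTE ik) oppr0 mulr0 addr0.
  by rewrite -tightP.
have jy : j \in T_ y.
  have ajr : dot (a j) r != 0 by rewrite gt_eqF.
  by rewrite tightP /y dot_step /f divfK// subrKC.
have qy : q - y = - dot (a k) (q - y) *: r.
  rewrite {1}(ray_expand (q - y) bT) (bigD1 k)//= big1 ?addr0 ?scaleNr// => i /andP[iT ik].
  by rewrite tq ?Ty// scale0r.
have /eqP := tq j jy; rewrite qy dotZr mulf_eq0 (gt_eqF Fj) orbF oppr_eq0 => /eqP ak.
by apply/eqP; rewrite -subr_eq0 qy ak oppr0 scale0r.
Qed.

Lemma segment_step x r (t : R) : 0 < t ->
  segment x (x + t *: r) = [set x + s *: r | s in [set s | 0 <= s <= t]].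
Proof.
move=> t0; have e u : (1 - u) *: x + u *: (x + t *: r) = x + (u * t) *: r.
  by rewrite scalerDr addrA -scalerDl subrK scale1r scalerA.
apply/seteqP; split => _ [u /= hu <-].
  move: hu; rewrite in_itv /= => /andP[u0 u1]; exists (u * t) => //=.
  by apply/andP; split; [rewrite mulr_ge0// ltW|rewrite ler_piMl// ltW].
move: hu => /andP[u0 u1]; exists (u / t); last by rewrite e divfK ?gt_eqF.
by rewrite /= in_itv /= ler_pdivrMr// mul1r u1 andbT divr_ge0// ltW.
Qed.

Lemma argmax_segment x k (t : R) g : vertex P x -> k \in T_ x -> 0 < t ->
  (forall s, P (x + s *: ray (T_ x) k) <-> 0 <= s <= t) ->
  dot g (ray (T_ x) k) = 0 ->
  (forall j, j \in T_ x -> j != k -> dot g (ray (T_ x) j) < 0) ->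
  [set p | P p /\ forall q, P q -> dot g q <= dot g p] =
  segment x (x + t *: ray (T_ x) k).
Proof.
move=> vx kT t0 Pt gk gj; have gr j : j \in T_ x -> dot g (ray (T_ x) j) <= 0.
  by move=> jT; have [->|jk] := eqVneq j k; [rewrite gk|apply/ltW/gj].
rewrite segment_step//; apply/seteqP; split => [p [Pp pmax]|_ [s hs <-]] /=.
  have px : p - x = (b k 0 - dot (a k) p) *: ray (T_ x) k.
    rewrite (vertex_diff p vx) (bigD1 k)//= big1 ?addr0// => j /andP[jT jk].
    rewrite (opt_slack vx gr Pp _ jT (gj _ jT jk)) ?subrr ?scale0r//.
    exact/pmax/vertex_mem.
  exists (b k 0 - dot (a k) p); last by rewrite -px addrC subrK.
  by apply/Pt; rewrite -px addrC subrK.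
split=> [|q Pq]; first exact/Pt.
by rewrite dotDr dotZr gk mulr0 addr0; exact: rays_le_opt.
Qed.

Lemma edge_ray x y : vertex P x -> edge P x y ->
  vertex P y /\ exists k, k \in T_ x /\
    exists2 t : R, 0 < t & y = x + t *: ray (T_ x) k.
Proof.
move=> vx [/eqP xy [l seg]]; have Px := vertex_mem vx.
have segx : segment x y x.
  by exists 0; rewrite /= ?in_itv /= ?lexx ?ler01// subr0 scale1r scale0r addr0.
have segy : segment x y y.
  by exists 1; rewrite /= ?in_itv /= ?lexx ?ler01// subrr scale1r scale0r add0r.
have : segment x y x by []; rewrite seg => -[_ xmax].
have : segment x y y by []; rewrite seg => -[Py ymax].
have lr k : k \in T_ x -> dot l (ray (T_ x) k) <= 0.
  move=> kT; have [t t0 [vt _]] := vertex_step vx kT.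
  have := xmax _ (vertex_mem vt); rewrite dotDr gerDl dotZr.
  by rewrite pmulr_rle0.
have [k [kT bk]] : exists k, k \in T_ x /\ b k 0 - dot (a k) y != 0.
  apply: contrapT => /forallNP h; move: xy; rewrite eq_sym -subr_eq0 => /eqP; apply.
  rewrite (vertex_diff y vx) big1// => k kT.
  have [->|bk] := eqVneq (b k 0 - dot (a k) y) 0; first by rewrite scale0r.
  by case: (h k).
have lk : dot l (ray (T_ x) k) = 0.
  apply/eqP; rewrite eq_le lr//= leNgt; apply/negP => lk.
  by move: bk; rewrite (opt_slack vx lr Py (ymax _ Px) kT lk) subrr eqxx.
have [t t0 [vt Pt]] := vertex_step vx kT.
have : segment x y (x + t *: ray (T_ x) k).
  rewrite seg; split=> [|q Pq]; first exact: vertex_mem.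
  by rewrite dotDr dotZr lk mulr0 addr0; exact: xmax.
move=> [u]; rewrite /= in_itv /= => /andP[u0 u1].
rewrite scalerBl scale1r -addrA => /addrI; rewrite addrC -scalerBr => e.
have u0' : 0 < u.
  rewrite lt_def u0 andbT; apply/eqP => u00; move: e; rewrite u00 scale0r.
  move=> /esym/eqP; rewrite scaler_eq0 gt_eqF//= => /eqP r0.
  by move: (ray_neq0 (vertex_basis vx) kT); rewrite r0 eqxx.
have yE : y = x + (t / u) *: ray (T_ x) k.
  have yx : y - x = (t / u) *: ray (T_ x) k.
    rewrite [t / u]mulrC -scalerA -e scalerA mulVf ?scale1r//.
    by rewrite gt_eqF.
  by rewrite -yx subrKC.
have tu : t / u = t.
  have : P y by []; rewrite yE => /Pt/andP[_ tut]; apply/eqP.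
  by rewrite eq_le tut /= ler_pdivlMr// ler_piMr// ltW.
rewrite tu in yE; split; first by rewrite yE.
by exists k; split => //; exists t.
Qed.

Lemma edgeC x y : edge P x y -> edge P y x.
Proof.
move=> [xy fxy]; split; first by move=> h; apply: xy.
rewrite (_ : segment y x = segment x y)//; apply/seteqP.
by split => _ [t /= ht <-]; exists (1 - t); rewrite /= ?opprB ?subrKC;
  move: ht; rewrite ?in_itv /= 1?addrC// => /andP[? ?]; apply/andP; split; lra.
Qed.

Definition vertex_set T := exists2 x, vertex P x & T_ x = T.

Lemma vertex_set_basis T : vertex_set T -> basis_set A T.
Proof. by move=> [x vx <-]; exact: vertex_basis. Qed.

(* The condition on the rays says that the vertex with tight set T is the
   unique maximiser of g; the last one that, for g + h, leaving facet i pays. *)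
Definition leaves (i : 'I_m) (g h : 'rV[R]_n) := exists T,
  [/\ vertex_set T, i \in T, forall k, k \in T -> dot g (ray T k) < 0 &
      0 <= dot (g + h) (ray T i)].

(* On facet i the maximisers of g and g + kappa a_i agree, so T is determined
   by g modulo a_i; the condition at ray T i then confines kappa. *)
Lemma leaves_disjoint i g h (kappa : R) : (exists j, a j != 0) ->
  0 < kappa -> enorm h <= kappa * delta A ->
  leaves i g h -> ~ leaves i (g + kappa *: a i) h.
Proof.
move=> nz k0 hk [_ [[x vx <-] ix gx hx]] [_ [[y vy <-] iy gy hy]].
have ax : dot (a i) x = b i 0 by apply/eqP; rewrite -tightP.
have ay : dot (a i) y = b i 0 by apply/eqP; rewrite -tightP.
have xy : y = x.
  have [gxy|gyx] := leP (dot g x) (dot g y).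
    exact: rays_lt_opt vx gx (vertex_mem vy) gxy.
  apply/esym/(rays_lt_opt vy gy (vertex_mem vx)).
  by rewrite !dotDl !dotZl ax ay lerD2r ltW.
rewrite xy in hy; have bT := vertex_basis vx.
have dA := delta_gt0 (proj2_sig (cid nz)).
have nr := enorm_ray nz bT ix; have cs := cauchy_schwarz h (ray (T_ x) i).
have : `|dot h (ray (T_ x) i)| <= kappa.
  apply: le_trans cs _; apply: le_trans (ler_pM _ _ hk nr) _; rewrite ?enorm_ge0//.
  by rewrite mulfK ?gt_eqF.
move: hy (gx i ix); rewrite !dotDl dotZl rayP// eqxx mulrN1 => hy gi.
by move=> /(le_trans (ler_norm _)); lra.
Qed.

End Polytope.

(** * The shadow path and its slopes *)

Section ShadowPath.
Context {R : realType} {m n : nat} (A : 'M[R]_(m, n)) (b : 'cV[R]_m).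
Hypothesis P_bounded : bounded_set (polyhedron A b).
Hypothesis P_nondeg : nondegenerate_polyhedron A b.
Context (c w : 'rV[R]_n).
Implicit Types (T : {set 'I_m}) (x y g h : 'rV[R]_n).
Local Notation P := (polyhedron A b).
Local Notation T_ x := (tight A b x).
Local Notation ray := (ray A).
Local Notation sh := (shadow c w).

Lemma dot2E (l p : 'rV[R]_2) : dot l p = l 0 0 * p 0 0 + l 0 1 * p 0 1.
Proof.
rewrite /dot !big_ord_recl big_ord0 addr0.
by rewrite (_ : lift ord0 ord0 = 1)//; exact/val_inj.
Qed.

Lemma shadow0 x : sh x 0 0 = dot c x. Proof. by rewrite mxE. Qed.

Lemma shadow1 x : sh x 0 1 = dot w x. Proof. by rewrite mxE. Qed.

Lemma shadow_comb (t : R) x y :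
  sh ((1 - t) *: x + t *: y) = (1 - t) *: sh x + t *: sh y.
Proof.
by apply/rowP => j; rewrite !mxE; case: ifP => _; rewrite dotDr !dotZr.
Qed.

Lemma shadow_segment x y : sh @` segment x y = segment (sh x) (sh y).
Proof.
apply/seteqP; split => [_ [_ [t ht <-] <-]|_ [t ht <-]].
  by exists t => //; rewrite shadow_comb.
by exists ((1 - t) *: x + t *: y); [exists t|rewrite shadow_comb].
Qed.

Lemma opt_rays x g : vertex P x -> (forall q, P q -> dot g q <= dot g x) ->
  forall k, k \in T_ x -> dot g (ray (T_ x) k) <= 0.
Proof.
move=> vx gx k kT; have [t t0 [vt _]] := vertex_step P_bounded P_nondeg vx kT.
by have := gx _ (vertex_mem vt); rewrite dotDr gerDl dotZr pmulr_rle0.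
Qed.

Lemma shadow_step_ray x k (sigma t : R) (y := x + t *: ray (T_ x) k) :
  vertex P x -> k \in T_ x -> 0 < t ->
  (forall s, P (x + s *: ray (T_ x) k) <-> 0 <= s <= t) ->
  0 < dot c (ray (T_ x) k) ->
  dot (sigma *: c - w) (ray (T_ x) k) = 0 ->
  (forall j, j \in T_ x -> j != k -> dot (sigma *: c - w) (ray (T_ x) j) < 0) ->
  shadow_step P c w x y.
Proof.
move=> vx kT t0 Pt ck gk gj; set g := sigma *: c - w.
have arg := argmax_segment P_nondeg vx kT t0 Pt gk gj.
have Py : P y by apply/Pt; rewrite lexx ltW.
have Px := vertex_mem vx.
have gy : dot g y = dot g x by rewrite dotDr dotZr gk mulr0 addr0.
have gmax q : P q -> dot g q <= dot g x.
  move=> Pq; have : segment x y x.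
    by exists 0; rewrite /= ?in_itv /= ?lexx ?ler01// subr0 scale1r scale0r addr0.
  by rewrite -arg => -[_]; exact.
have cxy : dot c x < dot c y by rewrite dotDr dotZr ltrDl mulr_gt0.
split.
  by split; [move=> xy; move: cxy; rewrite -xy ltxx|exists g].
pose l : 'rV[R]_2 := \row_j (if j == 0 then sigma else - 1).
have lsh q : dot l (sh q) = dot g q.
  by rewrite dot2E !mxE /= /g dotBl dotZl mulN1r.
split; last 2 first.
- by rewrite !shadow0.
- move=> _ [q Pq <-]; rewrite !shadow0 !shadow1.
  have := gmax q Pq; have := gy; rewrite /g !dotBl !dotZl => e hq.
  have -> : dot w y - dot w x = sigma * (dot c y - dot c x) by lra.
  rewrite (mulrC sigma) -mulrA ler_wpM2l ?subr_ge0 ?(ltW cxy)//; lra.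
split; first by move=> /(congr1 (fun p : 'rV[R]_2 => p 0 0)); rewrite !shadow0 => e;
  move: cxy; rewrite e ltxx.
exists l; rewrite -shadow_segment -arg; apply/seteqP; split.
  move=> _ [q [Pq qmax] <-]; split; first by exists q.
  by move=> _ [r Pr <-]; rewrite !lsh; exact: qmax.
move=> _ [[q Pq <-] qmax]; exists q => //; split=> // r Pr.
by rewrite -!lsh; apply: qmax; exists r.
Qed.

Definition slopes_distinct := forall T k l, vertex_set A b T -> k \in T ->
  l \in T -> k != l ->
  dot w (ray T k) * dot c (ray T l) != dot w (ray T l) * dot c (ray T k).

Lemma shadow_path_from N x (sigma : R) : slopes_distinct -> vertex P x ->
  (forall k, k \in T_ x -> dot (sigma *: c - w) (ray (T_ x) k) <= 0) ->
  (#|[set T | `[< exists y, [/\ vertex P y, T_ y = T & (dot c x < dot c y)%R] >]]%SET|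
     < N)%N ->
  exists s, is_shadow_path P c w x s.
Proof.
move=> dist; elim: N x sigma => // N ih x sigma vx gx.
set S := [set T | _]%SET => SN.
have [cT|] := pselect (forall k, k \in T_ x -> dot c (ray (T_ x) k) <= 0).
  exists [::]; split=> // _ [q Pq <-] /=; rewrite !shadow0.
  exact: (rays_le_opt P_nondeg vx cT Pq).
move=> /existsNP[k0 /not_implyP[k0T /negP]]; rewrite -ltNge => ck0.
pose F k := (k \in T_ x) && (0 < dot c (ray (T_ x) k)).
pose f k := dot w (ray (T_ x) k) / dot c (ray (T_ x) k).
have Fk0 : F k0 by rewrite /F k0T.
case: (Order.TotalTheory.arg_minP f Fk0) => k /andP[kT ck] mink.
have wk : dot w (ray (T_ x) k) = f k * dot c (ray (T_ x) k).
  by rewrite /f divfK// gt_eqF.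
have sk : sigma <= f k.
  by rewrite /f ler_pdivlMr// -subr_le0 -dotZl -dotBl gx.
have gk : dot (f k *: c - w) (ray (T_ x) k) = 0.
  by rewrite dotBl dotZl wk subrr.
have gj j : j \in T_ x -> j != k -> dot (f k *: c - w) (ray (T_ x) j) < 0.
  move=> jT jk; have vT : vertex_set A b (T_ x) by exists x.
  have := dist _ _ _ vT jT kT jk; rewrite wk => ne.
  rewrite lt_neqAle; apply/andP; split.
    apply: contraNneq ne; rewrite dotBl dotZl => /eqP; rewrite subr_eq0 => /eqP <-.
    by apply/eqP; ring.
  rewrite dotBl dotZl subr_le0; have [cj|cj] := ltP 0 (dot c (ray (T_ x) j)).
    by rewrite -ler_pdivlMr//; apply: mink; rewrite /F jT.
  have := gx j jT; rewrite dotBl dotZl subr_le0; apply: le_trans.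
  by rewrite ler_wnM2r.
have [t t0 [vy Pt]] := vertex_step P_bounded P_nondeg vx kT.
set y := x + _ in vy.
have cxy : dot c x < dot c y by rewrite dotDr dotZr ltrDl mulr_gt0.
have gr j : j \in T_ x -> dot (f k *: c - w) (ray (T_ x) j) <= 0.
  by move=> jT; have [->|jk] := eqVneq j k; [rewrite gk|exact/ltW/gj].
have gy : dot (f k *: c - w) y = dot (f k *: c - w) x.
  by rewrite dotDr dotZr gk mulr0 addr0.
have [s [ps rs]] : exists s, is_shadow_path P c w y s.
  apply: (ih y (f k) vy).
    by apply: opt_rays => // q Pq; rewrite gy; exact: (rays_le_opt P_nondeg vx gr Pq).
  move: SN; rewrite ltnS; apply: leq_trans; apply: proper_card; apply/properP; split.
    apply/fintype.subsetP => T; rewrite !inE => -[z [vz zT cz]].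
    by exists z; split => //; apply: lt_trans cz.
  exists (T_ y); first by rewrite inE; apply/asboolP; exists y.
  apply/negP; rewrite inE => /asboolP[z [vz zT cz]].
  by move: cz; rewrite (vertex_tight_inj P_nondeg vz zT) ltxx.
exists (y :: s); split => //=; rewrite ps andbT; apply/asboolP.
exact: (shadow_step_ray vx kT t0 Pt ck gk gj).
Qed.

Lemma shadow_path_exists x : slopes_distinct -> vertex P x ->
  (forall k, k \in T_ x -> 0 < dot w (ray (T_ x) k)) ->
  exists s, is_shadow_path P c w x s.
Proof.
move=> dist vx wx; apply: (@shadow_path_from _ x 0) => // k kT.
by rewrite dotBl dotZl mul0r sub0r oppr_le0 ltW// wx.
Qed.

Lemma shadow_step_cw x y : shadow_step P c w x y ->
  [/\ edge P x y, dot c x < dot c y &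
      forall q, P q -> (dot w y - dot w x) * (dot c q - dot c x) <=
                       (dot c y - dot c x) * (dot w q - dot w x)].
Proof.
move=> [exy [_]]; rewrite !shadow0 !shadow1 => cxy h; split=> // q Pq.
by have := h (sh q); rewrite shadow0 shadow1; apply; exists q.
Qed.

Lemma shadow_step_maximal x y q : shadow_step P c w x y -> P q ->
  (dot w y - dot w x) * (dot c q - dot c x) =
  (dot c y - dot c x) * (dot w q - dot w x) -> dot c q <= dot c y.
Proof.
move=> [[_ [l0 seg0]] [[_ [l seg]]]]; rewrite !shadow0 => cxy _ Pq e.
have Pend (t : R) : 0 <= t <= 1 -> segment (sh x) (sh y) ((1 - t) *: sh x + t *: sh y).
  by move=> ht; exists t => //; rewrite /= in_itv.
have : segment (sh x) (sh y) (sh x).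
  by have := Pend 0; rewrite subr0 scale1r scale0r addr0; apply; rewrite lexx ler01.
rewrite seg => -[Qx xmax].
have : segment (sh x) (sh y) (sh y).
  by have := Pend 1; rewrite subrr scale1r scale0r add0r; apply; rewrite lexx ler01.
rewrite seg => -[Qy ymax].
have lxy : dot l (sh x) = dot l (sh y) by apply/eqP; rewrite eq_le ymax// xmax.
have cxy0 : 0 < dot c y - dot c x by rewrite subr_gt0.
have lq : dot l (sh q) = dot l (sh x).
  move: lxy; rewrite !dot2E !shadow0 !shadow1 => lxy.
  have cne : dot c y - dot c x != 0 by rewrite gt_eqF.
  apply: (mulfI cne); apply/eqP; rewrite -subr_eq0; apply/eqP.
  transitivity ((dot c q - dot c x) * (l 0 0 * (dot c y - dot c x) +
      l 0 1 * (dot w y - dot w x)) + l 0 1 * ((dot c y - dot c x) * (dot w q - dot w x) -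
      (dot w y - dot w x) * (dot c q - dot c x))); first by ring.
  have z : l 0 0 * (dot c y - dot c x) + l 0 1 * (dot w y - dot w x) = 0 by lra.
  by rewrite e subrr mulr0 addr0 z mulr0.
have : segment (sh x) (sh y) (sh q).
  by rewrite seg; split=> [|r Qr]; [exists q|rewrite lq; exact: xmax].
move=> [t]; rewrite /= in_itv /= => /andP[t0 t1].
move=> /(congr1 (fun p : 'rV[R]_2 => p 0 0));
rewrite mxE [in X in X + _]mxE [in X in _ + X]mxE.
rewrite !shadow0 => <-; nra.
Qed.

End ShadowPath.

Lemma grid_cell {R : realType} (N : nat) (sigma : R) : (0 < N)%N ->
  0 < sigma <= 1 ->
  exists j : 'I_N, j%:R / N%:R < sigma <= j%:R / N%:R + N%:R^-1.
Proof.
move=> N0 /andP[s0 s1]; have NR : 0 < N%:R :> R by rewrite ltr0n.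
have ex : exists j, sigma <= j.+1%:R / N%:R.
  by exists N.-1; rewrite prednK// divff ?gt_eqF.
have jN : (ex_minn ex < N)%N.
  case: ex_minnP => j _ /(_ N.-1); rewrite prednK// divff ?gt_eqF// => /(_ s1) h.
  by rewrite -(prednK N0) ltnS.
exists (Ordinal jN) => /=; move: jN; case: ex_minnP => j sj minj _.
rewrite -[X in _ + X]mul1r -mulrDl natr1 sj andbT.
case: j sj minj => [|j] _ minj; first by rewrite mul0r.
by rewrite ltNge; apply/negP => /minj; rewrite ltnn.
Qed.

Lemma finite_separation {R : realType} (K : nat) (f : nat -> R) :
  (forall k l, (k < l < K)%N -> f k != f l) ->
  exists2 e : R, 0 < e & forall k l, (k < K)%N -> (l < K)%N -> k <> l ->
    e <= `|f k - f l|.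
Proof.
move=> inj; pose F (p : 'I_K * 'I_K) := `|f p.1 - f p.2|.
exists (\big[Order.min/1]_(p | p.1 != p.2) F p).
  elim/big_ind: _ => [//|x y x0 y0|[k l] /= kl]; first by rewrite lt_min x0 y0.
  rewrite normr_gt0 subr_eq0; case: (ltngtP k l) => h.
  - by apply: inj; rewrite h ltn_ord.
  - by rewrite eq_sym; apply: inj; rewrite h ltn_ord.
  - by case/eqP: kl; exact: val_inj.
move=> k l kK lK kl.
apply: (bigmin_le_cond (P := fun p : 'I_K * 'I_K => p.1 != p.2) _ F
  (j := (Ordinal kK, Ordinal lK))).
by apply/eqP => /(congr1 val).
Qed.

Section Counting.
Context {R : realType} {m n : nat} (A : 'M[R]_(m, n)) (b : 'cV[R]_m).
Hypothesis P_bounded : bounded_set (polyhedron A b).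
Hypothesis P_nondeg : nondegenerate_polyhedron A b.
Implicit Types (T : {set 'I_m}) (x y g h : 'rV[R]_n).
Local Notation P := (polyhedron A b).
Local Notation T_ x := (tight A b x).
Local Notation ray := (ray A).
Local Notation leaves := (leaves A b).

Definition regular_at g := forall T k, vertex_set A b T -> k \in T ->
  dot g (ray T k) != 0.

Lemma leaves_of_edge g h x y (alpha theta sigma e : R) :
  vertex P x -> edge P x y ->
  (forall q, P q -> dot (g + alpha *: h) q <= dot (g + alpha *: h) x) ->
  (forall q, P q -> dot (g + sigma *: h) q <= dot (g + sigma *: h) x) ->
  dot (g + sigma *: h) y = dot (g + sigma *: h) x ->
  dot h x <= dot h y ->
  alpha <= theta -> theta <= sigma -> sigma <= theta + e ->
  regular_at (g + theta *: h) ->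
  exists i, leaves i (g + theta *: h) (e *: h).
Proof.
move=> vx exy ax sx sxy hxy at_ ts st reg.
have [vy [i [iT [t t0 yx]]]] := edge_ray P_bounded P_nondeg vx exy.
exists i, (T_ x); split => //; first by exists x.
  move=> k kT; rewrite lt_neqAle reg//=; last by exists x.
  have := opt_rays P_bounded P_nondeg vx ax kT.
  have := opt_rays P_bounded P_nondeg vx sx kT.
  rewrite !dotDl !dotZl; have [h0|h0] := leP 0 (dot h (ray (T_ x) k)); nra.
move: sxy hxy; rewrite yx !dotDr !dotZr !dotDl !dotZl => sxy hxy.
have gs : dot g (ray (T_ x) i) + sigma * dot h (ray (T_ x) i) = 0.
  apply: (mulfI (lt0r_neq0 t0)); lra.
have hr : 0 <= dot h (ray (T_ x) i) by rewrite -(pmulr_rge0 _ t0); lra.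
by nra.
Qed.

Section Path.
Context (c w x0 C : 'rV[R]_n) (s : seq 'rV[R]_n) (rho : R).
(* Slopes are measured relative to C; with rho = n the threshold n between the
   two sweeps becomes 1. *)
Hypotheses (rho_gt0 : 0 < rho) (CE : C = rho *: c).
Hypothesis vx0 : vertex P x0.
Hypothesis x0_opt : forall k, k \in T_ x0 -> 0 < dot w (ray (T_ x0) k).
Hypothesis s_path : is_shadow_path P c w x0 s.

Let X k := nth x0 (x0 :: s) k.
Let slope k := (dot w (X k.+1) - dot w (X k)) / (dot C (X k.+1) - dot C (X k)).

Let X_step k : (k < size s)%N -> shadow_step P c w (X k) (X k.+1).
Proof. by move=> ks; have [/(pathP x0)/(_ k ks)/asboolP] := s_path. Qed.

Let X_vertex k : (k <= size s)%N -> vertex P (X k).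
Proof.
elim: k => [//|k ih] ks; have [e _ _] := shadow_step_cw (X_step ks).
by have [] := edge_ray P_bounded P_nondeg (ih (ltnW ks)) e.
Qed.

Let C_incr k : (k < size s)%N -> 0 < dot C (X k.+1) - dot C (X k).
Proof.
move=> ks; have [_ h _] := shadow_step_cw (X_step ks).
by rewrite CE !dotZl -mulrBr mulr_gt0// subr_gt0.
Qed.

Let slopeE k : (k < size s)%N ->
  dot w (X k.+1) - dot w (X k) = slope k * (dot C (X k.+1) - dot C (X k)).
Proof. by move=> ks; rewrite /slope divfK// gt_eqF// C_incr. Qed.

Let slope_opt k q : (k < size s)%N -> P q ->
  slope k * (dot C q - dot C (X k)) <= dot w q - dot w (X k).
Proof.
move=> ks Pq; have [_ _ /(_ q Pq) h] := shadow_step_cw (X_step ks).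
rewrite /slope mulrAC ler_pdivrMr ?C_incr// CE !dotZl.
by have := ler_wpM2l (ltW rho_gt0) h; lra.
Qed.

Let slope_max k q : (k < size s)%N -> P q ->
  slope k * (dot C q - dot C (X k)) = dot w q - dot w (X k) ->
  dot C q <= dot C (X k.+1).
Proof.
move=> ks Pq e; rewrite CE !dotZl ler_pM2l//.
apply: shadow_step_maximal (X_step ks) Pq _; rewrite -e slopeE//.
by rewrite CE !dotZl; ring.
Qed.

Let slope_ltS k : (k.+1 < size s)%N -> slope k < slope k.+1.
Proof.
move=> ks; have ks' := ltnW ks; rewrite ltNge; apply/negP => le.
have Pz := vertex_mem (X_vertex ks).
have C0 := C_incr ks; have := slope_opt ks' Pz.
have := slopeE ks; have := slopeE ks' => e1 e2 h.
have e : slope k * (dot C (X k.+2) - dot C (X k)) = dot w (X k.+2) - dot w (X k).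
  by apply/eqP; rewrite eq_le h /=; nra.
by have := slope_max ks' Pz e; lra.
Qed.

Let slope_lt k l : (k < l < size s)%N -> slope k < slope l.
Proof.
elim: l => // l ih /andP[]; rewrite ltnS leq_eqVlt => /orP[/eqP->|kl] ls.
  exact: slope_ltS.
apply: lt_trans (slope_ltS ls); apply: ih; rewrite kl; exact: ltnW.
Qed.

Let slope0_gt0 : (0 < size s)%N -> 0 < slope 0.
Proof.
move=> s0; rewrite divr_gt0// ?C_incr//; have [e _ _] := shadow_step_cw (X_step s0).
have [_ [k [kT [t t0 ->]]]] := edge_ray P_bounded P_nondeg vx0 e.
by rewrite dotDr dotZr [X in X - _]addrC addrK mulr_gt0// x0_opt.
Qed.

Let slope_gt0 k : (k < size s)%N -> 0 < slope k.
Proof.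
case: k => [|k] ks; first exact: slope0_gt0.
apply: lt_trans (slope0_gt0 (leq_ltn_trans _ ks)) _ => //.
by apply: slope_lt; rewrite ks.
Qed.

(* The two sweeps: - w + theta C for slopes at most 1 and, traversing the path
   backwards, C - theta w for the remaining ones, where theta is 1 / slope. *)
Definition sweep_base (f : bool) := if f then - w else C.
Definition sweep_dir (f : bool) := if f then C else - w.

Let forward_leaves k (theta e : R) : (k < size s)%N ->
  (if k is k'.+1 then slope k' else 0) <= theta -> theta <= slope k ->
  slope k <= theta + e -> regular_at (- w + theta *: C) ->
  exists i, leaves i (- w + theta *: C) (e *: C).
Proof.
move=> ks at_ ts st reg; have [exy _ _] := shadow_step_cw (X_step ks).
apply: (leaves_of_edge (X_vertex (ltnW ks)) exy _ _ _ _ at_ ts st reg).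
- move=> q Pq; rewrite !dotDl !dotNl !dotZl.
  case: k ks {at_ ts st exy} => [|k] ks.
    have x0w j : j \in T_ x0 -> dot (- w) (ray (T_ x0) j) <= 0.
      by move=> jT; rewrite dotNl oppr_le0 ltW// x0_opt.
    by have := rays_le_opt P_nondeg vx0 x0w Pq; rewrite !dotNl /X /= !mul0r; lra.
  have := slope_opt (ltnW ks) Pq; have := slopeE (ltnW ks); lra.
- move=> q Pq; rewrite !dotDl !dotNl !dotZl.
  by have := slope_opt ks Pq; lra.
- by rewrite !dotDl !dotNl !dotZl; have := slopeE ks; lra.
- by have := C_incr ks; lra.
Qed.

Let backward_leaves k (theta e : R) : (k < size s)%N ->
  (if k.+1 == size s then 0 else (slope k.+1)^-1) <= theta ->
  theta <= (slope k)^-1 -> (slope k)^-1 <= theta + e ->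
  regular_at (C + theta *: - w) ->
  exists i, leaves i (C + theta *: - w) (e *: - w).
Proof.
move=> ks at_ ts st reg; have [/edgeC exy _ _] := shadow_step_cw (X_step ks).
have sk := slope_gt0 ks; have scale (u v z : R) : 0 < z -> z * u <= v -> u <= z^-1 * v.
  by move=> z0 h; rewrite mulrC ler_pdivlMr// mulrC.
apply: (leaves_of_edge (X_vertex ks) exy _ _ _ _ at_ ts st reg).
- move=> q Pq; rewrite !dotDl !dotZl !dotNl.
  case: ifPn at_ => [/eqP ksz|kns] _.
    have [_ /(_ (shadow c w q))] := s_path; rewrite !shadow0 => h.
    have -> : X k.+1 = last x0 s by rewrite ksz /X -last_nth.
    rewrite !mul0r !addr0 CE !dotZl ler_pM2l//; apply: h; by exists q.
  have ks1 : (k.+1 < size s)%N by rewrite ltn_neqAle kns.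
  have := scale _ _ _ (slope_gt0 ks1) (slope_opt ks1 Pq); lra.
- move=> q Pq; rewrite !dotDl !dotZl !dotNl.
  have e1 : slope k * (dot C q - dot C (X k.+1)) <= dot w q - dot w (X k.+1).
    have := slope_opt ks Pq; have := slopeE ks; lra.
  have := scale _ _ _ sk e1; lra.
- rewrite !dotDl !dotZl !dotNl.
  have : (slope k)^-1 * (dot w (X k.+1) - dot w (X k)) = dot C (X k.+1) - dot C (X k).
    by rewrite slopeE// mulrA mulVf ?mul1r// gt_eqF.
  lra.
- rewrite !dotNl; have := mulr_gt0 sk (C_incr ks); rewrite -slopeE//; lra.
Qed.

Lemma path_count : exists N0 : nat, forall N : nat, (N0 < N)%N ->
  (forall (f : bool) (j : 'I_N),
     regular_at (sweep_base f + (j%:R / N%:R) *: sweep_dir f)) ->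
  (size s <= #|[set p : bool * 'I_N | `[< exists i,
     leaves i (sweep_base p.1 + (p.2%:R / N%:R) *: sweep_dir p.1)
       (N%:R^-1 *: sweep_dir p.1) >]]%SET|)%N.
Proof.
have [e e0 sepe] : exists2 e : R, 0 < e & forall k l, (k < size s)%N ->
    (l < size s)%N -> k <> l -> e <= `|slope k - slope l|.
  by apply: finite_separation => k l kl; rewrite lt_eqF// slope_lt.
have [e' e'0 sepe'] : exists2 e : R, 0 < e & forall k l, (k < size s)%N ->
    (l < size s)%N -> k <> l -> e <= `|(slope k)^-1 - (slope l)^-1|.
  apply: (@finite_separation R (size s) (fun k => (slope k)^-1)) => k l kl.
  by rewrite (inj_eq invr_inj) lt_eqF// slope_lt.
exists (maxn (Num.bound e^-1) (Num.bound e'^-1)) => N.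
rewrite gtn_max => /andP[Ne Ne'] reg.
have N0 : (0 < N)%N by apply: leq_ltn_trans Ne.
have small (z : R) : 0 < z -> (Num.bound z^-1 < N)%N -> N%:R^-1 < z.
  move=> z0 Nz; rewrite invf_plt ?posrE ?ltr0n//.
  apply: lt_trans (archi_boundP _) _; first by rewrite invr_ge0 ltW.
  by rewrite ltr_nat.
have {Ne} Ne := small _ e0 Ne; have {Ne'} Ne' := small _ e'0 Ne'.
pose val_ k := if slope k <= 1 then slope k else (slope k)^-1.
have val01 k : (k < size s)%N -> 0 < val_ k <= 1.
  move=> ks; rewrite /val_; case: (leP (slope k) 1) => h; first by rewrite slope_gt0.
  by rewrite invr_gt0 slope_gt0//= invf_le1 ?slope_gt0 ?ltW.
pose cell (k : 'I_(size s)) := sval (cid (grid_cell N0 (val01 k (ltn_ord k)))).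
have cellP (k : 'I_(size s)) : (cell k)%:R / N%:R < val_ k <= (cell k)%:R / N%:R + N%:R^-1.
  exact: (svalP (cid (grid_cell N0 (val01 k (ltn_ord k))))).
pose F (k : 'I_(size s)) : bool * 'I_N := (slope k <= 1, cell k).
have injF : injective F.
  move=> k l [bkl ckl]; apply/val_inj/eqP/negPn/negP => /eqP kl.
  have := cellP k; have := cellP l; rewrite ckl /val_ -bkl.
  case: (slope k <= 1) => /andP[h1 h2] /andP[h3 h4].
    have := sepe _ _ (ltn_ord k) (ltn_ord l) kl.
    by rewrite leNgt ltr_norml => /negP; apply; apply/andP; split; lra.
  have := sepe' _ _ (ltn_ord k) (ltn_ord l) kl.
  by rewrite leNgt ltr_norml => /negP; apply; apply/andP; split; lra.
rewrite -[X in (X <= _)%N]card_ord -(card_codom injF); apply: subset_leq_card.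
apply/fintype.subsetP => _ /codomP[k ->]; rewrite inE; apply/asboolP.
have := cellP k; have := reg (slope k <= 1) (cell k); rewrite /F /val_ /=.
have ks := ltn_ord k.
case: (leP (slope k) 1) => sk1 regk /andP[h1 h2].
  apply: (forward_leaves ks _ (ltW h1) h2 regk).
  case: k ks {regk sk1} h1 h2 => -[|k] kS /= ks h1 h2; first by rewrite divr_ge0.
  have := sepe _ _ ks (ltnW ks) (@nesym _ _ _ (n_Sn k)).
  rewrite gtr0_norm ?subr_gt0 ?slope_ltS//; lra.
apply: (backward_leaves ks _ (ltW h1) h2 regk).
case: ifPn => [_|kns]; first by rewrite divr_ge0.
have ks1 : (k.+1 < size s)%N by rewrite ltn_neqAle kns.
have := sepe' _ _ ks ks1 (n_Sn k); rewrite ger0_norm; first lra.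
by rewrite subr_ge0 lef_pV2 ?posrE ?slope_gt0// ltW// slope_ltS.
Qed.

End Path.
End Counting.

(** * Expected length of the path *)

Section MeasureExtras.
Context {R : realType} (d : measure_display) (T : measurableType d).
Local Open Scope ereal_scope.
Import HBNNSimple.

Lemma measurable_exists_fin (I : finType) (F : I -> set T) :
  (forall i, measurable (F i)) -> measurable [set x | exists i, F i x].
Proof.
move=> mF; have -> : [set x | exists i, F i x] = \big[setU/set0]_i F i.
  rewrite -bigcup_seq; apply/seteqP; split => [x [i Fi]|x [i _ Fi]]; exists i => //.
  by rewrite /= mem_index_enum.
by apply: bigsetU_measurable.
Qed.

Lemma measurable_forall_fin (I : finType) (F : I -> set T) :
  (forall i, measurable (F i)) -> measurable [set x | forall i, F i x].
Proof.
move=> mF; have -> : [set x | forall i, F i x] = \big[setI/setT]_i F i.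
  rewrite -bigcap_seq; apply/seteqP; split => [x h i _|x h i]; first exact: h.
  by apply: h; rewrite /= mem_index_enum.
by apply: bigsetI_measurable.
Qed.

Lemma measurable_cstP (P : Prop) : measurable [set _ : T | P].
Proof.
have [p|np] := pselect P.
  by rewrite (_ : [set _ | P] = setT)//; apply/seteqP; split.
by rewrite (_ : [set _ | P] = set0)//; apply/seteqP; split.
Qed.

Lemma measurable_imp (P : Prop) (F : set T) : measurable F ->
  measurable [set x | P -> F x].
Proof.
move=> mF; have -> : [set x | P -> F x] = [set _ | ~ P] `|` F.
  apply/seteqP; split => x /=; last by move=> [np /np|].
  by have [p|] := pselect P; [right; auto|left].
by apply: measurableU => //; exact: measurable_cstP.
Qed.

Lemma measurable_lt0 (f : T -> R) : measurable_fun setT f ->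
  measurable [set x | (f x < 0)%R].
Proof.
move=> mf; have := mf measurableT `]-oo, 0%R[%classic (measurable_itv _).
by rewrite setTI (_ : f @^-1` _ = [set x | (f x < 0)%R])//;
  apply/seteqP; split => x /=; rewrite in_itv.
Qed.

Lemma measurable_ge0 (f : T -> R) : measurable_fun setT f ->
  measurable [set x | (0 <= f x)%R].
Proof.
move=> mf; have := measurableC (measurable_lt0 mf).
by congr measurable; apply/seteqP; split => x /=; rewrite leNgt => /negP.
Qed.

Lemma measurable_eq0 (f : T -> R) : measurable_fun setT f ->
  measurable [set x | f x = 0%R].
Proof.
move=> mf; have := mf measurableT [set 0%R] (measurable_set1 _).
by rewrite setTI.
Qed.

Variable mu : {measure set T -> \bar R}.

Lemma ae_forall_countable (I : countType) (P : I -> T -> Prop) :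
  (forall i, {ae mu, forall x, P i x}) -> {ae mu, forall x, forall i, P i x}.
Proof.
move=> aeP; pose Q n x := if unpickle n is Some i then P i x else True.
have : {ae mu, forall x, forall n, Q n x}.
  apply: ae_foralln => n; rewrite /Q; case: (unpickle n) => [i|]; first exact: aeP.
  exact: aeW.
by apply: filterS => x Qx i; have := Qx (pickle i); rewrite /Q pickleK.
Qed.

(* The integral of f is a supremum over the simple functions below f, so f,
   unlike g, need not be measurable: the length of the path is such an f. *)
Lemma ae_le_integral (f g : T -> \bar R) : (forall x, 0 <= f x) ->
  (forall x, 0 <= g x) -> measurable_fun setT g ->
  {ae mu, forall x, f x <= g x} -> \int[mu]_x f x <= \int[mu]_x g x.
Proof.
move=> f0 g0 mg fg; rewrite ge0_integralTE//.
apply: ge_ereal_sup => _ [h /= hf <-]; rewrite -integralT_nnsfun.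
apply: ae_ge0_le_integral => //.
- by move=> x _; rewrite lee_fin.
- exact/measurable_EFinP.
- by apply: filterS fg => x fgx _; exact: le_trans (hf x) fgx.
Qed.

Lemma integral_le_eventually (f : T -> \bar R) (u : (T -> \bar R)^nat) (K : \bar R) :
  (forall x, 0 <= f x) -> (forall N x, 0 <= u N x) ->
  (forall N, measurable_fun setT (u N)) ->
  {ae mu, forall x, exists N0, forall N, (N0 <= N)%N -> f x <= u N x} ->
  (forall N, \int[mu]_x u N x <= K) -> \int[mu]_x f x <= K.
Proof.
move=> f0 u0 mu_ fu uK; have mlim : measurable_fun setT (fun x => limn_einf (u^~ x)).
  apply: (emeasurable_fun_cvg (fun N x => einfs (u^~ x) N)).
    by move=> N; exact: measurable_fun_einfs.
  by move=> x _; rewrite limn_einf_lim; exact: is_cvg_einfs.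
have flim : {ae mu, forall x, f x <= limn_einf (u^~ x)}.
  apply: filterS fu => x [N0 h]; rewrite limn_einf_lim.
  apply: lime_ge; first exact: is_cvg_einfs.
  exists N0 => // N /= N0N; apply: le_ereal_inf_tmp => _ [k /= Nk <-].
  by apply: h; exact: leq_trans Nk.
apply: le_trans (ae_le_integral f0 _ mlim flim) _.
  move=> x; rewrite limn_einf_lim; apply: lime_ge; first exact: is_cvg_einfs.
  by apply: nearW => N; apply: le_ereal_inf_tmp => _ [k _ <-].
apply: le_trans (fatou mu measurableT mu_ (fun N x _ => u0 N x)) _.
rewrite limn_einf_lim; apply: lime_le; first exact: is_cvg_einfs.
apply: nearW => N; apply: ge_ereal_inf; exists (\int[mu]_x u N x) => //.
by exists N => /=.
Qed.

End MeasureExtras.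

Section Randomised.
Context {R : realType} {m n : nat} (A : 'M[R]_(m, n)) (b : 'cV[R]_m).
Context (c0 x0 : 'rV[R]_n) (u : 'I_n -> 'I_m) (phi : R).
Context (lo hi : 'I_n -> R) (lohi : forall i, lo i < hi i).
Context (d : measure_display) (Omega : measurableType d) (Pr : probability Omega R)
  (c lambda : 'I_n -> {RV Pr >-> R}).
Hypothesis A_unit : forall i, enorm (row i A) = 1.
Hypothesis P_bounded : bounded_set (polyhedron A b).
Hypothesis P_nondeg : nondegenerate_polyhedron A b.
Hypothesis c0_unit : enorm c0 = 1.
Hypothesis vx0 : vertex (polyhedron A b) x0.
Hypothesis u_inj : injective u.
Hypothesis u_tight : [set u k | k : 'I_n]%SET = tight A b x0.
Hypothesis phi_ge : Num.sqrt n%:R <= phi.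
Hypothesis lohi_len : forall i, hi i - lo i = phi^-1.
Hypothesis c0_box : forall i, lo i <= c0 0 i <= hi i.
Hypothesis law_c : forall i (B : set R), measurable B ->
  distribution Pr (c i) B = uniform_prob (lohi i) B.
Hypothesis law_lambda : forall k (B : set R), measurable B ->
  distribution Pr (lambda k) B = uniform_prob (@ltr01 R) B.
Hypothesis indep : mutually_independent (sum_family c lambda).
Hypothesis lambda_gt0 : forall k omega, 0 < lambda k omega.

Local Notation P := (polyhedron A b).
Local Notation T_ x := (tight A b x).
Local Notation a i := (row i A).
Local Notation I := ('I_n + 'I_n)%type.
Local Notation E := (@coord_space R I).
Local Notation X := (sum_family c lambda).
Local Notation J := (joint X).
Local Notation ray := (ray A).

Let lo' : I -> R := sum_family lo (fun=> 0).
Let hi' : I -> R := sum_family hi (fun=> 1).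

Let lohi' i : lo' i < hi' i.
Proof. by case: i => [i|k]; [exact: lohi|exact: ltr01]. Qed.

Let lawX i (B : set R) : measurable B ->
  distribution Pr (X i) B = uniform_prob (lohi' i) B.
Proof. by case: i => [i|k] mB /=; [rewrite law_c|rewrite law_lambda]. Qed.

Let Q := box lo' hi'.

Definition cvec (x : E) : 'rV[R]_n := \row_i x (inl i).
Definition wvec (x : E) : 'rV[R]_n := - \sum_k x (inr k) *: a (u k).

Let C (x : E) := n%:R *: cvec x.

Let n_gt0 : (0 < n)%N.
Proof.
rewrite lt0n; apply/eqP => n0; move: c0_unit; rewrite /enorm /dot.
rewrite big1 ?sqrtr0 => [/eqP|i]; first by rewrite eq_sym oner_eq0.
by exfalso; have := leq_ltn_trans (leq0n i) (ltn_ord i); rewrite n0.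
Qed.

Let nR_gt0 : 0 < n%:R :> R. Proof. by rewrite ltr0n. Qed.

Let phi_gt0 : 0 < phi.
Proof. by apply: lt_le_trans phi_ge; rewrite sqrtr_gt0. Qed.

Let uT k : u k \in T_ x0.
Proof. by rewrite -u_tight imset_f. Qed.

Let bT0 : basis_set A (T_ x0). Proof. exact: vertex_basis. Qed.

Let A_neq0 : exists i, a i != 0.
Proof.
exists (u (Ordinal n_gt0)); rewrite -enorm_eq0 A_unit; exact: oner_neq0.
Qed.

Let delta_pos : 0 < delta A.
Proof. by have [i ai] := A_neq0; exact: delta_gt0 ai. Qed.

Let coef y k := - dot y (ray (T_ x0) (u k)).

Let coefE y : y = \sum_k coef y k *: a (u k).
Proof.
rewrite {1}(row_expand y bT0) -u_tight big_imset => [|k l _ _ /u_inj//].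
by rewrite -sumrN; apply: eq_big => [k|k _]; rewrite ?inE// u_tight scaleNr.
Qed.

Let coef_le i k : `|coef (a i) k| <= (delta A)^-1.
Proof.
rewrite normrN; apply: le_trans (cauchy_schwarz _ _) _.
by rewrite A_unit mul1r enorm_ray.
Qed.

Let enorm_cvec x : Q x -> enorm (cvec x) <= 2.
Proof.
move=> Qx; have -> : cvec x = c0 + (cvec x - c0) by rewrite addrC subrK.
apply: le_trans (ler_enormD _ _) _; rewrite c0_unit.
suff h : enorm (cvec x - c0) <= 1 by lra.
apply: le_trans (enorm_le_sqrt (e := phi^-1) _ _) _.
- by rewrite invr_ge0 ltW.
- move=> i; rewrite !mxE -(lohi_len i); have := Qx (inl i); have := c0_box i.
  by rewrite in_itv /= ler_norml => /andP[? ?] /andP[? ?]; apply/andP; split; lra.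
- by rewrite ler_pdivrMr// mul1r.
Qed.

Let enorm_wvec x : Q x -> enorm (wvec x) <= n%:R.
Proof.
move=> Qx; rewrite /wvec enormN; apply: le_trans (ler_enorm_sum _ _ _) _.
rewrite -[X in _ <= X%:R]card_ord -sumr_const; apply: ler_sum => k _.
rewrite enormZ A_unit mulr1; have := Qx (inr k); rewrite in_itv /= => /andP[? ?].
by rewrite ger0_norm.
Qed.

Let measurable_dot_c z : measurable_fun setT (fun x : E => dot (C x) z).
Proof.
have -> : (fun x : E => dot (C x) z) = fun x => \sum_i n%:R * (x (inl i) * z 0 i).
  apply/funext => x; rewrite dotZl mulr_sumr; apply: eq_bigr => i _.
  by rewrite mxE.
apply: measurable_sum => i; apply: measurable_funM => //.
by apply: measurable_funM => //; exact: measurable_coord.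
Qed.

Let measurable_dot_w z : measurable_fun setT (fun x : E => dot (wvec x) z).
Proof.
have -> : (fun x : E => dot (wvec x) z) =
    fun x => \sum_k - (x (inr k) * dot (a (u k)) z).
  apply/funext => x; rewrite dotNl dot_suml -sumrN; apply: eq_bigr => i _.
  by rewrite dotZl.
apply: measurable_sum => i; apply: measurable_funN.
by apply: measurable_funM => //; exact: measurable_coord.
Qed.

Let base f x := sweep_base (wvec x) (C x) f.
Let dir f x := sweep_dir (wvec x) (C x) f.

Let measurable_sweep f (t : R) z :
  measurable_fun setT (fun x : E => dot (base f x + t *: dir f x) z).
Proof.
have -> : (fun x : E => dot (base f x + t *: dir f x) z) =
    fun x => dot (base f x) z + t * dot (dir f x) z.
  by apply/funext => x; rewrite dotDl dotZl.
have mN : measurable_fun setT (fun x : E => dot (- wvec x) z).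
  rewrite (_ : (fun x : E => dot (- wvec x) z) = \- (fun x => dot (wvec x) z)).
    exact: measurable_funN.
  by apply/funext => x; rewrite dotNl.
by apply: measurable_funD; [case: f|apply: measurable_funM => //; case: f].
Qed.

Let ev (f : bool) (t e : R) (i : 'I_m) : set E :=
  [set x | leaves A b i (base f x + t *: dir f x) (e *: dir f x)].

Let measurable_ev f t e i : measurable (ev f t e i).
Proof.
apply: measurable_exists_fin => T.
have -> : (fun x : E => [/\ vertex_set A b T, i \in T,
      forall k, k \in T -> dot (base f x + t *: dir f x) (ray T k) < 0 &
      0 <= dot (base f x + t *: dir f x + e *: dir f x) (ray T i)]) =
    [set _ | vertex_set A b T /\ i \in T] `&`
    ([set x | forall k, k \in T -> dot (base f x + t *: dir f x) (ray T k) < 0] `&`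
    [set x | 0 <= dot (base f x + (t + e) *: dir f x) (ray T i)]).
  apply/funext => x; apply/propext; rewrite /setI /= scalerDl addrA.
  by split=> [[? ? ? ?]|[[? ?] [? ?]]].
apply: measurableI; first exact: measurable_cstP.
apply: measurableI; last exact: (measurable_ge0 (measurable_sweep f (t + e) (ray T i))).
apply: measurable_forall_fin => k; apply: measurable_imp.
exact: (measurable_lt0 (measurable_sweep f t (ray T k))).
Qed.

Let cshift (v : 'rV[R]_n) : E := sum_family (fun i => v 0 i) (fun=> 0).
Let wshift (y : 'rV[R]_n) : E := sum_family (fun=> 0) (coef y).

Let add_cshift x t v : C (fun i => x i + t * cshift v i) = C x + (n%:R * t) *: v /\
  wvec (fun i => x i + t * cshift v i) = wvec x.
Proof.
split; first by apply/rowP => i; rewrite !mxE mulrDr mulrA.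
by rewrite /wvec; congr (- _); apply: eq_bigr => k _; rewrite /= mulr0 addr0.
Qed.

Let add_wshift x t y : C (fun i => x i + t * wshift y i) = C x /\
  - wvec (fun i => x i + t * wshift y i) = - wvec x + t *: y.
Proof.
split; first by apply/rowP => i; rewrite !mxE /= mulr0 addr0.
rewrite /wvec !opprK {2}(coefE y) scaler_sumr -big_split /=.
by apply: eq_bigr => k _; rewrite scalerDl scalerA.
Qed.

Let shift f y : E := if f then wshift y else cshift (n%:R^-1 *: y).

Let add_shift f x t y :
  base f (fun i => x i + t * shift f y i) = base f x + t *: y /\
  dir f (fun i => x i + t * shift f y i) = dir f x.
Proof.
rewrite /base /dir /sweep_base /sweep_dir /shift; case: f.
  by have [-> ->] := add_wshift x t y.
have [-> ->] := add_cshift x t (n%:R^-1 *: y); split => //.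
by rewrite scalerA mulrAC divff ?mul1r// gt_eqF.
Qed.

Let dir_le f x : Q x -> enorm (dir f x) <= if f then 2 * n%:R else n%:R.
Proof.
move=> Qx; rewrite /dir /sweep_dir; case: f; last by rewrite enormN enorm_wvec.
by rewrite /C enormZ ger0_norm// mulrC ler_wpM2r// enorm_cvec.
Qed.

Let rate (f : bool) : R :=
  if f then 2 * n%:R ^+ 2 / delta A ^+ 2 else Num.sqrt n%:R * phi / delta A.

Let shift_rate f i : (if f then 2 * n%:R else n%:R) / delta A *
  (\sum_p `|shift f (a i) p| / (hi' p - lo' p)) <= rate f.
Proof.
rewrite big_sumType /=; under eq_bigr do rewrite lohi_len invrK.
under [X in _ + X]eq_bigr do rewrite subr0 divr1.
rewrite -mulr_suml /rate /shift; case: f => /=.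
  rewrite big1 ?mul0r ?add0r => [|k _]; last by rewrite normr0.
  apply: (@le_trans _ _ (2 * n%:R / delta A * (n%:R * (delta A)^-1))).
    rewrite ler_wpM2l//; first by rewrite ltW// divr_gt0// mulr_gt0.
    rewrite mulr_natl -[X in _ *+ X]card_ord -sumr_const.
    by apply: ler_sum => k _; exact: coef_le.
  by rewrite le_eqVlt; apply/orP; left; apply/eqP; field; rewrite gt_eqF.
rewrite [X in _ + X]big1 ?addr0 => [|k _]; last by rewrite normr0.
under eq_bigr do rewrite mxE normrM gtr0_norm ?invr_gt0//.
rewrite -mulr_sumr.
apply: (@le_trans _ _ (n%:R / delta A * (n%:R^-1 * (Num.sqrt n%:R * 1) * phi))).
  rewrite ler_wpM2l//; first by rewrite ltW// divr_gt0.
  rewrite ler_wpM2r ?(ltW phi_gt0)// ler_wpM2l ?invr_ge0 ?(ltW nR_gt0)//.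
  by have := l1_le_enorm (a i); rewrite A_unit.
by rewrite le_eqVlt; apply/orP; left; apply/eqP; field; rewrite !gt_eqF.
Qed.

Let prob_ev f t e i : 0 < e -> (Pr (J @^-1` ev f t e i) <= (e * rate f)%:E)%E.
Proof.
move=> e0; pose kappa := e * (if f then 2 * n%:R else n%:R) / delta A.
have kappa0 : 0 < kappa.
  by rewrite /kappa divr_gt0// mulr_gt0//; case: ifP => //; rewrite mulr_gt0.
pose v : E := fun p => kappa * shift f (a i) p.
apply: le_trans (prob_disjoint_translates (lohi := lohi') lawX indep (v := v) _ _) _ => //.
  move=> j x evx Qx; have -> : (fun p => x p + v p *+ j.+1) =
      fun p => x p + (kappa *+ j.+1) * shift f (a i) p.
    by apply/funext => p; rewrite mulrnAl.
  rewrite /ev /=; have [-> ->] := add_shift f x (kappa *+ j.+1) (a i).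
  move=> evx' _; move: evx'; rewrite addrAC.
  apply: (leaves_disjoint P_nondeg A_neq0 _ _ evx); first by rewrite pmulrn_lgt0.
  rewrite enormZ gtr0_norm//; apply: (@le_trans _ _ (kappa * delta A)).
    by rewrite /kappa divfK ?gt_eqF// ler_wpM2l ?dir_le// ltW.
  by rewrite ler_pM2r// mulrS lerDl mulrn_wge0// ltW.
rewrite lee_fin.
under eq_bigr do rewrite normrM (gtr0_norm kappa0) -mulrA.
rewrite -mulr_sumr /kappa -!mulrA ler_wpM2l ?(ltW e0)// mulrA.
exact: shift_rate.
Qed.

Let null_regular f t T k : vertex_set A b T -> k \in T ->
  {ae Pr, forall om, dot (base f (J om) + t *: dir f (J om)) (ray T k) != 0}.
Proof.
move=> vT kT; pose B : set E := [set x | dot (base f x + t *: dir f x) (ray T k) = 0].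
have mB : measurable B by exact: (measurable_eq0 (measurable_sweep f t (ray T k))).
exists (J @^-1` B); split; first exact: measurable_joint_preimage.
  apply: (null_disjoint_translates (lohi := lohi') lawX indep (v := shift f (a k))) => //.
  move=> s x s0; rewrite /B /=; have [-> ->] := add_shift f x s (a k).
  rewrite !dotDl !dotZl (rayP (vertex_set_basis P_nondeg vT) kT kT) eqxx mulrN1 => h h'.
  by move: s0; rewrite (_ : s = 0) ?ltxx//; lra.
by move=> om /negP; rewrite negbK => /eqP.
Qed.

Let null_slopes T k l : vertex_set A b T -> k \in T -> l \in T -> k != l ->
  {ae Pr, forall om, dot (wvec (J om)) (ray T k) * dot (C (J om)) (ray T l) !=
                     dot (wvec (J om)) (ray T l) * dot (C (J om)) (ray T k)}.
Proof.
move=> vT kT lT kl; have bT := vertex_set_basis P_nondeg vT.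
pose h (x : E) := dot (wvec x) (ray T k) * dot (C x) (ray T l) -
                  dot (wvec x) (ray T l) * dot (C x) (ray T k).
pose B : set E := [set x | h x = 0] `\` [set x | dot (wvec x) (ray T l) = 0].
have mB : measurable B.
  apply: measurableD; apply: measurable_eq0; last exact: measurable_dot_w.
  by apply: measurable_funB; apply: measurable_funM.
have nB : {ae Pr, forall om, ~ B (J om)}.
  exists (J @^-1` B); split; first exact: measurable_joint_preimage.
    apply: (null_disjoint_translates (lohi := lohi') lawX indep (v := cshift (a k))) => //.
    move=> s x s0; rewrite /B /h /=; have [-> ->] := add_cshift x s (a k).
    rewrite !dotDl !dotZl !rayP// eqxx (negbTE kl) oppr0 mulrN1 mulr0 addr0.
    move=> -[h1 w0] [h2 _]; apply: w0.
    have ns : n%:R * s != 0 by rewrite mulf_neq0// gt_eqF.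
    by apply: (mulfI ns); lra.
  by move=> om /contrapT.
have nw := null_regular true 0 vT lT.
apply: filterS2 nB nw => om nB nw; apply/eqP => e; apply: nB; split.
  by rewrite /= /h e subrr.
move=> /= w0; move: nw; rewrite /base /dir /sweep_base scale0r addr0 dotNl w0.
by rewrite oppr0 eqxx.
Qed.

Let good om :=
  slopes_distinct A b (cvec (J om)) (wvec (J om)) /\
  forall (N : nat) (j : 'I_N) f,
    regular_at A b (base f (J om) + (j%:R / N%:R) *: dir f (J om)).

Let good_ae : {ae Pr, forall om, good om}.
Proof.
have h1 : {ae Pr, forall om, forall p : {set 'I_m} * ('I_m * 'I_m),
    vertex_set A b p.1 -> p.2.1 \in p.1 -> p.2.2 \in p.1 -> p.2.1 != p.2.2 ->
    dot (wvec (J om)) (ray p.1 p.2.1) * dot (C (J om)) (ray p.1 p.2.2) !=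
    dot (wvec (J om)) (ray p.1 p.2.2) * dot (C (J om)) (ray p.1 p.2.1)}.
  apply: ae_forall_countable => -[T [k l]] /=.
  have [[vT [kT [lT kl]]]|no] :=
    pselect (vertex_set A b T /\ k \in T /\ l \in T /\ k != l).
    by apply: filterS (null_slopes vT kT lT kl).
  by apply: aeW => om vT kT lT kl; case: no.
have h2 : {ae Pr, forall om, forall p : nat * nat * bool * ({set 'I_m} * 'I_m),
    vertex_set A b p.2.1 -> p.2.2 \in p.2.1 ->
    dot (base p.1.2 (J om) + (p.1.1.1%:R / p.1.1.2%:R) *: dir p.1.2 (J om))
      (ray p.2.1 p.2.2) != 0}.
  apply: ae_forall_countable => -[[[j N] f] [T k]] /=.
  have [[vT kT]|no] := pselect (vertex_set A b T /\ k \in T).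
    by apply: filterS (null_regular f (j%:R / N%:R) vT kT).
  by apply: aeW => om vT kT; case: no.
apply: filterS2 h1 h2 => om h1 h2; split.
  move=> T k l vT kT lT kl; have := h1 (T, (k, l)) vT kT lT kl.
  rewrite /= !dotZl !mulrA ![_ * n%:R]mulrC -!mulrA.
  by apply: contraNneq => ->.
by move=> N j f T k vT kT; exact: (h2 ((nat_of_ord j, N, f), (T, k))).
Qed.

Let x0_opt om k : k \in T_ x0 -> 0 < dot (wvec (J om)) (ray (T_ x0) k).
Proof.
rewrite -{1}u_tight => /imsetP[l _ ->]; rewrite dotNl dot_suml -sumrN.
rewrite (bigD1 l)//= dotZl rayP// eqxx mulrN1 opprK big1 ?addr0 => [|j jl].
  exact: lambda_gt0.
by rewrite dotZl rayP// (inj_eq u_inj) (negbTE jl) oppr0 mulr0 oppr0.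
Qed.

Let output om := shadow_path P (cvec (J om)) (wvec (J om)) x0.

Lemma output_shadow_path_ae :
  {ae Pr, forall om, is_shadow_path P (cvec (J om)) (wvec (J om)) x0 (output om)}.
Proof.
apply: filterS good_ae => om [dist _].
have [s hs] := shadow_path_exists P_bounded P_nondeg dist vx0 (@x0_opt om).
exact: (xgetPex [::] (ex_intro _ s hs)).
Qed.

Let cnt (N : nat) (om : Omega) : \bar R :=
  (\sum_(p : bool * 'I_N) \sum_(i < m)
    (\1_(J @^-1` ev p.1 (p.2%:R / N%:R) N%:R^-1 i) om)%:E)%E.

Let measurable_ind N (p : bool * 'I_N) i : measurable_fun setT
  (fun om => (\1_(J @^-1` ev p.1 (p.2%:R / N%:R) N%:R^-1 i) om)%:E : \bar R).
Proof.
apply/measurable_EFinP; apply: measurable_indic.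
by apply: measurable_joint_preimage; exact: measurable_ev.
Qed.

Let integral_cnt N : (0 < N)%N ->
  (\int[Pr]_om cnt N om <= (m%:R * (rate true + rate false))%:E)%E.
Proof.
move=> N0; have NR : 0 < N%:R :> R by rewrite ltr0n.
rewrite /cnt ge0_integral_sum//; last 2 first.
- by move=> p; apply: emeasurable_sum => i.
- by move=> p om _; apply: sume_ge0 => i _; rewrite lee_fin.
apply: (@le_trans _ _ (\sum_(p : bool * 'I_N) \sum_(i < m)
    (N%:R^-1 * rate p.1)%:E)%E).
  apply: lee_sum => p _; rewrite ge0_integral_sum//.
  apply: lee_sum => i _; rewrite integral_indic//; last first.
    by apply: measurable_joint_preimage; exact: measurable_ev.
  by rewrite setIT prob_ev// invr_gt0.
under eq_bigr do rewrite sumEFin; rewrite sumEFin lee_fin.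
have cell_rate f : \sum_(j < N) \sum_(i < m) N%:R^-1 * rate f = m%:R * rate f.
  rewrite !sumr_const !card_ord -mulrnA mulnC mulrnA -mulrnAl -(mulr_natl _ N).
  by rewrite divff ?gt_eqF// mul1r mulr_natl.
rewrite -(pair_bigA _ (fun f (j : 'I_N) => \sum_(i < m) N%:R^-1 * rate f)).
by rewrite big_bool !cell_rate mulrDr.
Qed.

Let size_le_cnt : {ae Pr, forall om, exists N0 : nat, forall N, (N0 <= N)%N ->
  ((size (output om))%:R%:E <= cnt N.+1 om)%E}.
Proof.
apply: filterS2 good_ae output_shadow_path_ae => om [_ reg] path_om.
have [N0 hN] := path_count P_bounded P_nondeg nR_gt0 (erefl (C (J om))) vx0
  (@x0_opt om) path_om.
exists N0 => N N0N; rewrite /cnt; under eq_bigr do rewrite sumEFin.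
rewrite sumEFin lee_fin; apply: le_trans (_ : _ <= _%:R) _.
  rewrite ler_nat; apply: (hN N.+1); first by rewrite ltnS.
  by move=> f j; exact: reg.
rewrite -sum1_card natr_sum big_mkcond /=; apply: ler_sum => p _.
rewrite inE; case: asboolP => [[i lv]|_]; last exact: sumr_ge0.
rewrite (bigD1 i)//= indicE mem_set//= lerDl; exact: sumr_ge0.
Qed.

Lemma expected_size_le :
  ('E_Pr [fun om => (size (output om))%:R] <=
     (2 * (m%:R * n%:R ^+ 2 / delta A ^+ 2 +
           m%:R * Num.sqrt n%:R * phi / delta A))%:E)%E.
Proof.
apply: (@le_trans _ _ (m%:R * (rate true + rate false))%:E); last first.
  pose x := m%:R * n%:R ^+ 2 / delta A ^+ 2.
  pose y := m%:R * Num.sqrt n%:R * phi / delta A.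
  have y0 : 0 <= y.
    apply: divr_ge0 (ltW delta_pos); apply: mulr_ge0 (ltW phi_gt0).
    by apply: mulr_ge0 => //; exact: sqrtr_ge0.
  have -> : m%:R * (rate true + rate false) = 2 * x + y.
    by rewrite /rate /x /y; ring.
  by rewrite lee_fin -/x -/y mulrDr lerD2l; lra.
rewrite unlock; apply: (@integral_le_eventually _ _ _ Pr
  (fun om => (size (output om))%:R%:E) (fun N => cnt N.+1)).
- by move=> om; rewrite lee_fin.
- by move=> N om; apply: sume_ge0 => p _; apply: sume_ge0 => i _; rewrite lee_fin.
- by move=> N; apply: emeasurable_sum => p; apply: emeasurable_sum => i.
- exact: size_le_cnt.
- by move=> N; exact: integral_cnt.
Qed.

End Randomised.

Theorem theorem3 (R : realType) :
  exists2 C : R, 0 < C &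
  forall (m n : nat) (A : 'M[R]_(m, n)) (b : 'cV[R]_m)
    (c0 x0 : 'rV[R]_n) (u : 'I_n -> 'I_m) (phi : R)
    (lo hi : 'I_n -> R) (lohi : forall i, lo i < hi i)
    (d : measure_display) (Omega : measurableType d) (Pr : probability Omega R)
    (c lambda : 'I_n -> {RV Pr >-> R}),
  (forall i, enorm (row i A) = 1) ->
  bounded_set (polyhedron A b) ->
  nondegenerate_polyhedron A b ->
  enorm c0 = 1 ->
  vertex (polyhedron A b) x0 ->
  injective u ->
  [set u k | k : 'I_n]%SET = tight A b x0 ->
  Num.sqrt n%:R <= phi ->
  (forall i, hi i - lo i = phi^-1) ->
  (forall i, -1 <= lo i /\ hi i <= 1) ->
  (forall i, lo i <= c0 0 i <= hi i) ->
  (forall i (B : set R), measurable B ->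
     distribution Pr (c i) B = uniform_prob (lohi i) B) ->
  (forall k omega, 0 < lambda k omega <= 1) ->
  (forall k (B : set R), measurable B ->
     distribution Pr (lambda k) B = uniform_prob (@ltr01 R) B) ->
  mutually_independent (sum_family c lambda) ->
  let cvec omega : 'rV[R]_n := \row_i c i omega in
  let w omega : 'rV[R]_n := - \sum_k lambda k omega *: row (u k) A in
  let output omega :=
    shadow_path (polyhedron A b) (cvec omega) (w omega) x0 in
  {ae Pr, forall omega,
     is_shadow_path (polyhedron A b) (cvec omega) (w omega) x0
       (output omega)} /\
  ('E_Pr [fun omega => (size (output omega))%:R] <=
     (C * (m%:R * n%:R ^+ 2 / delta A ^+ 2 +
           m%:R * Num.sqrt n%:R * phi / delta A))%:E)%E.
Proof.
exists 2 => // m n A b c0 x0 u phi lo hi lohi d Omega Pr c lambda.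
move=> A_unit P_bounded P_nondeg c0_unit vx0 u_inj u_tight phi_ge lohi_len _.
move=> c0_box law_c lambda01 law_lambda indep cvec w output.
have lambda_gt0 k omega : 0 < lambda k omega by have /andP[] := lambda01 k omega.
split.
  exact: (output_shadow_path_ae P_bounded P_nondeg c0_unit vx0 u_inj u_tight
    law_c law_lambda indep lambda_gt0).
exact: (expected_size_le A_unit P_bounded P_nondeg c0_unit vx0 u_inj u_tight
  phi_ge lohi_len c0_box law_c law_lambda indep lambda_gt0).
Qed.
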